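(* For all $k \in \mathbb{N}^+$, $\mathsf{RRT}^{!\omega}_k \leq_{\mathrm{sW}} \mathsf{RT}^{!\omega}_k$. Moreover $\mathsf{RCA}_0 \vdash \forall k\, (\mathsf{RT}^{!\omega}_k \to \mathsf{RRT}^{!\omega}_k)$.
   Context: For $X \subseteq \mathbb{N}$, $[X]^{!\omega}$ is the set of finite $s \subseteq X$ with $|s| = 1+\min s$. A function $f : Y \to \mathbb{N}$ is $k$-bounded if $|f^{-1}(i)| \leq k$ for all $i$. $\mathsf{RT}^{!\omega}_k$: instances are $f : [\mathbb{N}]^{!\omega} \to \{0,\dots,k-1\}$, solutions are infinite $H \subseteq \mathbb{N}$ with $|f([H]^{!\omega})| = 1$. $\mathsf{RRT}^{!\omega}_k$: instances are $k$-bounded $f : [\mathbb{N}]^{!\omega} \to \mathbb{N}$, solutions are infinite $H \subseteq \mathbb{N}$ such that $f$ is injective on $[H]^{!\omega}$. $\mathsf{Q} \leq_{\mathrm{sW}} \mathsf{P}$ means there are Turing functionals $\Phi, \Psi$ such that for every instance $X$ of $\mathsf{Q}$, $\Phi(X)$ is an instance of $\mathsf{P}$ and for every solution $Y$ to $\mathsf{P}$ for $\Phi(X)$, $\Psi(Y)$ is a solution to $\mathsf{Q}$ for $X$. $\mathsf{RCA}_0$ is Robinson arithmetic plus $\Sigma^0_1$-induction and $\Delta^0_1$-comprehension. *)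

(* Defs.v *)
From Stdlib Require List.
From mathcomp Require Import all_boot finmap.
From mathcomp Require Import boolp classical_sets functions cardinality.

Set Implicit Arguments.
Unset Strict Implicit.
Unset Printing Implicit Defensive.

Local Open Scope classical_set_scope.
Local Open Scope card_scope.

(* Syntax of the partial recursive functions of n variables, relative to an
   oracle.  They serve as indices of Turing functionals. *)
Inductive prec : nat -> Type :=
| PZero n : prec n
| PSucc : prec 1
| PProj n : 'I_n -> prec n
| POracle : prec 1
| PComp m n : prec m -> ('I_m -> prec n) -> prec n
| PRec n : prec n -> prec n.+2 -> prec n.+1
| PMin n : prec n.+1 -> prec n.

(* [eval X e v y]: the partial function with index e and oracle X converges on
   the arguments v, with value y.  The oracle is queried through the
   characteristic function of X.  In primitive recursion and minimization the
   distinguished variable is the first one; [r i] is the value at stage i of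
   the recursion. *)
Fixpoint eval (X : set nat) n (e : prec n) : n.-tuple nat -> nat -> Prop :=
  match e in prec n return n.-tuple nat -> nat -> Prop with
  | PZero _ => fun _ y => y = 0
  | PSucc => fun v y => y = (thead v).+1
  | PProj _ i => fun v y => y = tnth v i
  | POracle => fun v y => y = `[< X (thead v) >]
  | PComp m _ f g => fun v y =>
      exists2 w : m.-tuple nat,
        forall i, eval X (g i) v (tnth w i) & eval X f w y
  | PRec _ f g => fun v y =>
      exists r : nat -> nat,
        [/\ eval X f [tuple of behead v] (r 0),
            forall i, i < thead v ->
              eval X g [tuple of i :: r i :: behead v] (r i.+1)
          & y = r (thead v)]
  | PMin _ f => fun v y =>
      eval X f [tuple of y :: v] 0 /\
      forall i, i < y -> exists z, eval X f [tuple of i :: v] z.+1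
  end.

Definition computes (e : prec 1) (X Y : set nat) : Prop :=
  forall n, eval X e [tuple n] `[< Y n >].

Record problem := Problem {
  instance : set (set nat);
  solution : set nat -> set (set nat)
}.

Definition sW_le (Q P : problem) : Prop :=
  exists Phi Psi : prec 1, forall X, instance Q X ->
    exists Y, [/\ computes Phi X Y, instance P Y
      & forall Z, solution P Y Z ->
          exists2 W, computes Psi Z W & solution Q X W].

(* |s| = 1 + min s; this excludes the empty set, which has no minimum. *)
Definition exactly_large (s : {fset nat}) : bool :=
  [exists m : s, [forall x : s, val m <= val x] && (#|` s| == (val m).+1)].

(* [N]^{!omega} *)
Definition elarge : choiceType := {s : {fset nat} | exactly_large s}.

(* [X]^{!omega} *)
Definition elarge_in (X : set nat) : set elarge :=
  [set s | [set` val s] `<=` X].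

(* Functions on [N]^{!omega} are presented to Turing functionals as subsets of
   N, namely their graphs, a finite set being coded by its canonical (binary)
   index and a pair (i, j) by (i + j)^2 + i. *)
Definition npair (i j : nat) : nat := (i + j) ^ 2 + i.

Definition fset_code (s : {fset nat}) : nat := \sum_(i <- s) 2 ^ i.

Definition graph (f : elarge -> nat) : set nat :=
  range (fun s : elarge => npair (fset_code (val s)) (f s)).

Definition bounded_fun T (k : nat) (f : T -> nat) : Prop :=
  forall i, f @^-1` [set i] #<= `I_k.

Definition RT (k : nat) : problem := {|
  instance := [set X | exists2 f : elarge -> nat,
                 X = graph f & forall s, f s < k];
  solution := fun X => [set H | infinite_set H /\
                 exists2 f : elarge -> nat,
                   X = graph f & f @` elarge_in H #= `I_1]
|}.

Definition RRT (k : nat) : problem := {|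
  instance := [set X | exists2 f : elarge -> nat,
                 X = graph f & bounded_fun k f];
  solution := fun X => [set H | infinite_set H /\
                 exists2 f : elarge -> nat,
                   X = graph f & set_inj (elarge_in H) f]
|}.

Declare Scope term_scope.
Delimit Scope term_scope with T.
Declare Scope formula_scope.
Delimit Scope formula_scope with F.

(* Number variables and set variables are two independent families of de Bruijn
   indices; the only set terms are the variables. *)
Inductive term := Var of nat | Zero | One | Add of term & term | Mul of term & term.
Bind Scope term_scope with term.

Inductive formula :=
| EqT of term & term
| LtT of term & term
| MemS of term & nat
| Bot
| Imp of formula & formula
| All1 of formula
| All2 of formula.
Bind Scope formula_scope with formula.
Arguments EqT (_ _)%_T.
Arguments LtT (_ _)%_T.
Arguments MemS _%_T _%_N.

Notation "''v_' n" := (Var n) (at level 8, n at level 2, format "''v_' n").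
Notation "0" := Zero : term_scope.
Notation "1" := One : term_scope.
Notation "a + b" := (Add a b) : term_scope.
Notation "a * b" := (Mul a b) : term_scope.

Definition Not p := Imp p Bot.
Definition And p q := Not (Imp p (Not q)).
Definition Or p q := Imp (Not p) q.
Definition Iff p q := And (Imp p q) (Imp q p).
Definition Ex1 p := Not (All1 (Not p)).
Definition Ex2 p := Not (All2 (Not p)).

Notation "a = b" := (EqT a b) : formula_scope.
Notation "a < b" := (LtT a b) : formula_scope.
Notation "~ p" := (Not p) : formula_scope.
Notation "p ==>> q" := (Imp p q)
  (at level 90, right associativity) : formula_scope.
Notation "p /\ q" := (And p q) : formula_scope.
Notation "p \/ q" := (Or p q) : formula_scope.
Notation "p <-> q" := (Iff p q) : formula_scope.

Local Open Scope formula_scope.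

Fixpoint tsubst (s : nat -> term) (t : term) : term :=
  match t with
  | Var i => s i
  | Zero => Zero
  | One => One
  | Add a b => Add (tsubst s a) (tsubst s b)
  | Mul a b => Mul (tsubst s a) (tsubst s b)
  end.

Definition tlift (n : nat) : term -> term := tsubst (fun i => Var (n + i)).

Definition scons T (x : T) (s : nat -> T) (i : nat) : T :=
  if i is j.+1 then s j else x.

Definition up1 (s : nat -> term) : nat -> term := scons 'v_0 (tlift 1 \o s).
Definition up2 (r : nat -> nat) : nat -> nat := scons 0 (succn \o r).

(* Simultaneous substitution of terms for the number variables and of set
   variables for the set variables. *)
Fixpoint subst (s : nat -> term) (r : nat -> nat) (p : formula) : formula :=
  match p with
  | EqT a b => EqT (tsubst s a) (tsubst s b)
  | LtT a b => LtT (tsubst s a) (tsubst s b)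
  | MemS a X => MemS (tsubst s a) (r X)
  | Bot => Bot
  | Imp p q => Imp (subst s r p) (subst s r q)
  | All1 p => All1 (subst (up1 s) r p)
  | All2 p => All2 (subst s (up2 r) p)
  end.

Definition shift1 : formula -> formula := subst (fun i => Var i.+1) id.
Definition shift2 : formula -> formula := subst Var succn.
Definition inst1 (t : term) : formula -> formula := subst (scons t Var) id.
Definition inst2 (X : nat) : formula -> formula := subst Var (scons X id).

(* Classical natural deduction from a set T of axioms.  The free variables of
   an axiom are understood as universally quantified, whence rule D_ax is
   available in every context. *)
Inductive proves (T : formula -> Prop) : seq formula -> formula -> Prop :=
| D_ax G p : T p -> proves T G p
| D_hyp G p : List.In p G -> proves T G p
| D_impI G p q : proves T (p :: G) q -> proves T G (p ==>> q)
| D_impE G p q : proves T G (p ==>> q) -> proves T G p -> proves T G q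
| D_dne G p : proves T G (~ ~ p) -> proves T G p
| D_all1I G p : proves T (map shift1 G) p -> proves T G (All1 p)
| D_all1E G p t : proves T G (All1 p) -> proves T G (inst1 t p)
| D_all2I G p : proves T (map shift2 G) p -> proves T G (All2 p)
| D_all2E G p X : proves T G (All2 p) -> proves T G (inst2 X p)
| D_refl G t : proves T G (t = t)
| D_eq G p t u :
    proves T G (t = u) -> proves T G (inst1 t p) -> proves T G (inst1 u p).

(* Bounded formulas; being lifted, the bound t does not contain the variable
   that is quantified. *)
Inductive Delta0 : formula -> Prop :=
| Delta0_Eq a b : Delta0 (a = b)
| Delta0_Lt a b : Delta0 (a < b)
| Delta0_Mem a X : Delta0 (MemS a X)
| Delta0_Bot : Delta0 Bot
| Delta0_Imp p q : Delta0 p -> Delta0 q -> Delta0 (p ==>> q)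
| Delta0_All t p : Delta0 p -> Delta0 (All1 ('v_0 < tlift 1 t ==>> p))
| Delta0_Ex t p : Delta0 p -> Delta0 (Ex1 ('v_0 < tlift 1 t /\ p)).

Inductive Sigma1 : formula -> Prop :=
| Sigma1_Ex p : Delta0 p -> Sigma1 (Ex1 p).

Inductive Pi1 : formula -> Prop :=
| Pi1_All p : Delta0 p -> Pi1 (All1 p).

(* Q_1 -- Q_8 are the axioms of Robinson arithmetic, with x + 1 as the successor
   of x and with the defining axiom of the order.  In the induction and
   comprehension schemes the distinguished variable is 'v_0, and all other free
   variables of p and q are parameters. *)
Inductive RCA0 : formula -> Prop :=
| Q_1 : RCA0 (~ 'v_0 + 1 = 0)
| Q_2 : RCA0 ('v_0 + 1 = 'v_1 + 1 ==>> 'v_0 = 'v_1)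
| Q_3 : RCA0 ('v_0 = 0 \/ Ex1 ('v_1 = 'v_0 + 1))
| Q_4 : RCA0 ('v_0 + 0 = 'v_0)
| Q_5 : RCA0 ('v_0 + ('v_1 + 1) = ('v_0 + 'v_1) + 1)
| Q_6 : RCA0 ('v_0 * 0 = 0)
| Q_7 : RCA0 ('v_0 * ('v_1 + 1) = 'v_0 * 'v_1 + 'v_0)
| Q_8 : RCA0 ('v_0 < 'v_1 <-> Ex1 ('v_0 + ('v_1 + 1) = 'v_2))
| Sigma1_induction p : Sigma1 p ->
    RCA0 (inst1 0 p ==>>
          All1 (p ==>> subst (scons ('v_0 + 1)%T (fun i => Var i.+1)) id p) ==>>
          All1 p)
| Delta1_comprehension p q : Sigma1 p -> Pi1 q ->
    RCA0 (All1 (p <-> q) ==>> Ex2 (All1 (MemS 'v_0 0 <-> shift2 p))).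

(* The coding of finite sets in RCA_0 is Simpson's (Subsystems of Second Order
   Arithmetic, II.2): a triple (k, (m, n)) represents the finite set of all
   x < k such that m (x + 1) + 1 divides n, and the code of a finite set is the
   least number that represents it.  The parameters of the formulas below are
   terms and set variables in the outer context. *)

Definition tpair (a b : term) : term := ((a + b) * (a + b) + a)%T.

Definition divides (a b : term) : formula := Ex1 (tlift 1 b = tlift 1 a * 'v_0).

(* x belongs to the finite set represented by c; a number that is not a triple
   represents the empty set. *)
Definition FIn (x c : term) : formula :=
  Ex1 (Ex1 (Ex1
    (tlift 3 c = tpair 'v_2 (tpair 'v_1 'v_0) /\
     (tlift 3 x < 'v_2 /\
      divides ('v_1 * (tlift 3 x + 1) + 1) 'v_0)))).

Definition FCode (c : term) : formula :=
  All1 ('v_0 < tlift 1 c ==>>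
        ~ All1 (FIn 'v_0 'v_1 <-> FIn 'v_0 (tlift 2 c))).

(* The finite set s has n elements: some finite set of pairs is the graph of a
   bijection from the numbers below n onto s. *)
Definition FCard (s n : term) : formula :=
  Ex1 (* 'v_0 = bijection *)
    (All1 (FIn 'v_0 'v_1 ==>>
           Ex1 (Ex1 ('v_2 = tpair 'v_1 'v_0 /\
                     ('v_1 < tlift 4 n /\ FIn 'v_0 (tlift 4 s))))) /\
     (All1 ('v_0 < tlift 2 n ==>>
            Ex1 (FIn (tpair 'v_1 'v_0) 'v_2 /\
                 All1 (FIn (tpair 'v_2 'v_0) 'v_3 ==>> 'v_0 = 'v_1))) /\
      All1 (FIn 'v_0 (tlift 2 s) ==>>
            Ex1 (FIn (tpair 'v_0 'v_1) 'v_2 /\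
                 All1 (FIn (tpair 'v_0 'v_2) 'v_3 ==>> 'v_0 = 'v_1))))).

(* s is the code of an element of [N]^{!omega} *)
Definition FElarge (s : term) : formula :=
  FCode s /\
  Ex1 (* 'v_0 = min s *)
    (FIn 'v_0 (tlift 1 s) /\
     (All1 (FIn 'v_0 (tlift 2 s) ==>> ~ 'v_0 < 'v_1) /\
      FCard (tlift 1 s) ('v_0 + 1))).

(* s is the code of an element of [X]^{!omega} *)
Definition FElarge_in (s : term) (X : nat) : formula :=
  FElarge s /\ All1 (FIn 'v_0 (tlift 1 s) ==>> MemS 'v_0 X).

(* F is a function from [N]^{!omega} to N *)
Definition FFun (F : nat) : formula :=
  All1 (MemS 'v_0 F ==>>
        Ex1 (Ex1 ('v_2 = tpair 'v_1 'v_0 /\ FElarge 'v_1))) /\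
  All1 (FElarge 'v_0 ==>>
        Ex1 (MemS (tpair 'v_1 'v_0) F /\
             All1 (MemS (tpair 'v_2 'v_0) F ==>> 'v_0 = 'v_1))).

Definition FInfinite (H : nat) : formula :=
  All1 (Ex1 (MemS 'v_0 H /\ ~ 'v_0 < 'v_1)).

Definition FColoring (k : term) (F : nat) : formula :=
  All1 (All1 (MemS (tpair 'v_1 'v_0) F ==>> 'v_0 < tlift 2 k)).

(* For each i, some b is the code of F^{-1}(i), and |b| = n for some n <= k. *)
Definition FBounded (k : term) (F : nat) : formula :=
  All1 (Ex1 (Ex1
    ((FCode 'v_1 /\ All1 (FIn 'v_0 'v_2 <-> MemS (tpair 'v_0 'v_3) F)) /\
     (FCard 'v_1 'v_0 /\ ~ tlift 3 k < 'v_0)))).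

(* |F([H]^{!omega})| = 1 *)
Definition FHomogeneous (H F : nat) : formula :=
  Ex1 (All1
    (Ex1 (FElarge_in 'v_0 H /\ MemS (tpair 'v_0 'v_1) F) <-> 'v_0 = 'v_1)).

Definition FRainbow (H F : nat) : formula :=
  All1 (All1 (All1
    (FElarge_in 'v_2 H ==>> FElarge_in 'v_1 H ==>>
     MemS (tpair 'v_2 'v_0) F ==>> MemS (tpair 'v_1 'v_0) F ==>>
     'v_2 = 'v_1))).

(* Below, the instance is the set variable 1 and the solution is 0. *)
Definition FRT (k : term) : formula :=
  All2 (FFun 0 /\ FColoring k 0 ==>> Ex2 (FInfinite 0 /\ FHomogeneous 0 1)).

Definition FRRT (k : term) : formula :=
  All2 (FFun 0 /\ FBounded k 0 ==>> Ex2 (FInfinite 0 /\ FRainbow 0 1)).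

(* Main.v *)
From HB Require Import structures.
Require Import Defs.
From mathcomp Require Import all_boot.
From mathcomp Require Import boolp.
From Stdlib Require Import Ring.

(* Given a k-bounded f, colour an exactly large set s by the number g(s) of the
   exactly large sets t of smaller code with f(t) = f(s).  Then g(s) < k, as
   the fiber of s has at most k elements, and g is injective on each fiber of f;
   hence f is injective on [H]^{!omega} whenever g is constant there, so that
   the backward functional is the identity.

   For the derivability in RCA_0, Henkin's completeness theorem reduces the claim
   to the same argument in an arbitrary model.  There, counting is a Delta^0_1
   operation by means of Simpson's codes of finite sets, and a coded bijection
   between n and a fiber forces the count of the fiber to be n, whence
   g(s) < n <= k.  Counting also shows that FElarge, which is only Sigma^0_1 on
   its face, defines a set, a necessary condition for g to exist as one. *)

Set Implicit Arguments.
Unset Strict Implicit.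
Unset Printing Implicit Defensive.

(** * Completeness of the natural deduction *)

(** No derivation is ever written out: syntax is confined to completeness, and the argument runs in
    a model whose numbers may be nonstandard, so that nothing can be borrowed from [nat] and each
    induction or comprehension has to exhibit its formula. The language needs no Henkin constants.
    Contexts are finite and every instance of an axiom is derivable, so some variable is always
    fresh and can act as a witness; the terms already present then form the model. Inside the model
    the obstacle is that recursion is not primitive in RCA_0, hence neither is counting. A count is
    defined through certificates: a number codes a set of pairs, each justified by an earlier pair.
    Existence of a certificate is Sigma^0_1, uniqueness of the certified value gives an equivalent
    Pi^0_1 form, and Delta^0_1 comprehension yields the graph of the counting function as a set.
    Cardinality and exact largeness are then bounded statements about such graphs. The bound k,
    however, is given only through coded bijections, and passing from a bijection to a count takes
    an induction of its own, [bij_count]. *)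

Lemma up1_var : up1 Var = Var.
Proof. by apply: funext; case. Qed.

Lemma up2_id : up2 id = id.
Proof. by apply: funext; case. Qed.

Lemma tsubst_var t : tsubst Var t = t.
Proof. by elim: t => //= a -> b ->. Qed.

Lemma subst_var p : subst Var id p = p.
Proof.
elim: p => //= [a b|a b|a X|p -> q ->|p IH|p IH]; rewrite ?tsubst_var //.
  by rewrite up1_var IH.
by rewrite up2_id IH.
Qed.

Lemma tsubst_comp s s' t : tsubst s' (tsubst s t) = tsubst (tsubst s' \o s) t.
Proof. by elim: t => //= a -> b ->. Qed.

Lemma up1_comp s s' : tsubst (up1 s') \o up1 s = up1 (tsubst s' \o s).
Proof.
by apply: funext => -[|i] //=; rewrite /tlift !tsubst_comp.
Qed.

Lemma up2_comp r r' : up2 r' \o up2 r = up2 (r' \o r).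
Proof. by apply: funext; case. Qed.

Lemma subst_comp s r s' r' p :
  subst s' r' (subst s r p) = subst (tsubst s' \o s) (r' \o r) p.
Proof.
elim: p s r s' r' => //= [a b|a b|a X|p IHp q IHq|p IH|p IH] s r s' r'.
- by rewrite !tsubst_comp.
- by rewrite !tsubst_comp.
- by rewrite tsubst_comp.
- by rewrite IHp IHq.
- by rewrite IH up1_comp.
- by rewrite IH up2_comp.
Qed.

Lemma subst_shift1 s r p : subst (up1 s) r (shift1 p) = shift1 (subst s r p).
Proof. by rewrite /shift1 !subst_comp. Qed.

Lemma subst_shift2 s r p : subst s (up2 r) (shift2 p) = shift2 (subst s r p).
Proof.
rewrite /shift2 !subst_comp; congr subst.
by apply: funext => i /=; rewrite tsubst_var.
Qed.

Lemma inst1_subst s r t p : inst1 t (subst (up1 s) r p) = subst (scons t s) r p.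
Proof.
rewrite /inst1 subst_comp; congr subst; apply: funext => -[|i] //=.
by rewrite /tlift tsubst_comp tsubst_var.
Qed.

Lemma inst2_subst s r X p : inst2 X (subst s (up2 r) p) = subst s (scons X r) p.
Proof.
rewrite /inst2 subst_comp; congr subst.
  by apply: funext => i /=; rewrite tsubst_var.
by apply: funext; case.
Qed.

Lemma subst_inst1 s r t p :
  subst s r (inst1 t p) = inst1 (tsubst s t) (subst (up1 s) r p).
Proof.
rewrite inst1_subst /inst1 subst_comp; congr subst.
by apply: funext; case.
Qed.

Lemma subst_inst2 s r X p :
  subst s r (inst2 X p) = inst2 (r X) (subst s (up2 r) p).
Proof.
by rewrite inst2_subst /inst2 subst_comp; congr subst; apply: funext; case.
Qed.

(* Every free number (resp. set) variable of [p] is smaller than [n]. *)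
Definition below1 n p :=
  forall s s' r, (forall i, i < n -> s i = s' i) -> subst s r p = subst s' r p.
Definition below2 n p :=
  forall s r r', (forall i, i < n -> r i = r' i) -> subst s r p = subst s r' p.

Lemma tbelow_ex t : exists n, forall s s',
  (forall i, i < n -> s i = s' i) -> tsubst s t = tsubst s' t.
Proof.
elim: t => [i|||a [m Ha] b [n Hb]|a [m Ha] b [n Hb]].
- by exists i.+1 => s s' /(_ i (ltnSn i)).
- by exists 0.
- by exists 0.
- exists (maxn m n) => s s' H /=; rewrite (Ha s s') 1?(Hb s s') // => i Hi;
    by apply: H; rewrite leq_max Hi ?orbT.
- exists (maxn m n) => s s' H /=; rewrite (Ha s s') 1?(Hb s s') // => i Hi;
    by apply: H; rewrite leq_max Hi ?orbT.
Qed.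

Lemma below1_ex p : exists n, below1 n p.
Proof.
elim: p => [a b|a b|a X||p [m Hp] q [n Hq]|p [n Hp]|p [n Hp]].
- have [m Ha] := tbelow_ex a; have [n Hb] := tbelow_ex b.
  exists (maxn m n) => s s' r H /=; rewrite (Ha s s') 1?(Hb s s') // => i Hi;
    by apply: H; rewrite leq_max Hi ?orbT.
- have [m Ha] := tbelow_ex a; have [n Hb] := tbelow_ex b.
  exists (maxn m n) => s s' r H /=; rewrite (Ha s s') 1?(Hb s s') // => i Hi;
    by apply: H; rewrite leq_max Hi ?orbT.
- have [m Ha] := tbelow_ex a.
  by exists m => s s' r H /=; rewrite (Ha s s').
- by exists 0.
- exists (maxn m n) => s s' r H /=; rewrite (Hp s s') 1?(Hq s s') // => i Hi;
    by apply: H; rewrite leq_max Hi ?orbT.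
- exists n => s s' r H /=; congr All1; apply: Hp => -[|i] //= Hi.
  by rewrite H // ltnW.
- by exists n => s s' r H /=; rewrite (Hp s s').
Qed.

Lemma below2_ex p : exists n, below2 n p.
Proof.
elim: p => [a b|a b|a X||p [m Hp] q [n Hq]|p [n Hp]|p [n Hp]].
- by exists 0.
- by exists 0.
- by exists X.+1 => s r r' /(_ X (ltnSn X)) /= ->.
- by exists 0.
- exists (maxn m n) => s r r' H /=; rewrite (Hp s r r') 1?(Hq s r r') // => i Hi;
    by apply: H; rewrite leq_max Hi ?orbT.
- by exists n => s r r' H /=; rewrite (Hp _ r r').
- exists n => s r r' H /=; congr All2; apply: Hp => -[|i] //= Hi.
  by rewrite H // ltnW.
Qed.

Lemma below1_leq m n p : m <= n -> below1 m p -> below1 n p.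
Proof. by move=> mn H s s' r E; apply: H => i /leq_trans /(_ mn) /E. Qed.

Lemma below2_leq m n p : m <= n -> below2 m p -> below2 n p.
Proof. by move=> mn H s r r' E; apply: H => i /leq_trans /(_ mn) /E. Qed.

Lemma fresh1 (G : seq formula) : exists n, forall p, List.In p G -> below1 n p.
Proof.
elim: G => [|q G [n Hn]]; first by exists 0.
have [m Hm] := below1_ex q; exists (maxn m n) => p /= [<-|/Hn].
  by apply: below1_leq Hm; rewrite leq_maxl.
by apply: below1_leq; rewrite leq_maxr.
Qed.

Lemma fresh2 (G : seq formula) : exists n, forall p, List.In p G -> below2 n p.
Proof.
elim: G => [|q G [n Hn]]; first by exists 0.
have [m Hm] := below2_ex q; exists (maxn m n) => p /= [<-|/Hn].
  by apply: below2_leq Hm; rewrite leq_maxl.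
by apply: below2_leq; rewrite leq_maxr.
Qed.

(** * Weakening, substitution and generalization in derivations *)

Section Proofs.
Variable T : formula -> Prop.

Lemma weaken G G' p : List.incl G G' -> proves T G p -> proves T G' p.
Proof.
move=> GG' H; elim: H G' GG' => {G p}.
- by move=> G p Tp G' _; apply: D_ax.
- by move=> G p Gp G' GG'; apply: D_hyp; apply: GG'.
- move=> G p q _ IH G' GG'; apply: D_impI; apply: IH => r /= [->|/GG']; first by left.
  by right.
- by move=> G p q _ IH1 _ IH2 G' GG'; apply: D_impE (IH1 _ GG') (IH2 _ GG').
- by move=> G p _ IH G' GG'; apply: D_dne; apply: IH.
- by move=> G p _ IH G' GG'; apply: D_all1I; apply: IH; apply: List.incl_map.
- by move=> G p t _ IH G' GG'; apply: D_all1E; apply: IH.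
- by move=> G p _ IH G' GG'; apply: D_all2I; apply: IH; apply: List.incl_map.
- by move=> G p X _ IH G' GG'; apply: D_all2E; apply: IH.
- by move=> G t G' _; apply: D_refl.
- by move=> G p t u _ IH1 _ IH2 G' GG'; apply: D_eq (IH1 _ GG') (IH2 _ GG').
Qed.

Lemma proves_subst_lt1 n p s : proves T [::] p ->
  proves T [::] (subst (fun i => if i < n then s i else Var (i - n)) id p).
Proof.
elim: n p s => [|n IH] p s Hp.
  rewrite (_ : (fun _ => _) = Var) ?subst_var //.
  by apply: funext => i /=; rewrite subn0.
have H1 : proves T [::] (All1 p) by apply: D_all1I.
(* [s 0] is lifted by n because the n instantiations still to come lower its variables by n. *)
have /(IH _ (s \o succn)) := D_all1E (tlift n (s 0)) H1.
rewrite /inst1 subst_comp; congr (proves _ _ (subst _ _ _)).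
apply: funext => -[|i] //=.
rewrite /tlift tsubst_comp -[RHS]tsubst_var; congr tsubst.
by apply: funext => i /=; rewrite ltnNge leq_addr /= addKn.
Qed.

Lemma proves_subst_lt2 n p r : proves T [::] p ->
  proves T [::] (subst Var (fun i => if i < n then r i else i - n) p).
Proof.
elim: n p r => [|n IH] p r Hp.
  rewrite (_ : (fun _ => _) = id) ?subst_var //.
  by apply: funext => i /=; rewrite subn0.
have H1 : proves T [::] (All2 p) by apply: D_all2I.
have /(IH _ (r \o succn)) := D_all2E (n + r 0) H1.
rewrite /inst2 subst_comp; congr (proves _ _ (subst _ _ _)).
apply: funext => -[|i] //=.
by rewrite ltnNge leq_addr /= addKn.
Qed.

(* The axioms need not be closed under substitution, so that their instances
   are obtained by generalizing and instantiating one variable at a time. *)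
Lemma proves_closed_subst s r p : proves T [::] p -> proves T [::] (subst s r p).
Proof.
move=> Hp; have [n Hn] := below1_ex p; have [m Hm] := below2_ex p.
have := proves_subst_lt2 m r (proves_subst_lt1 n s Hp).
rewrite subst_comp.
rewrite (Hm _ _ r); last by move=> i /= ->.
rewrite (Hn _ s) // => i /= ->.
by rewrite tsubst_var.
Qed.

Lemma proves_subst G p s r :
  proves T G p -> proves T (map (subst s r) G) (subst s r p).
Proof.
move=> H; elim: H s r => {G p}.
- move=> G p Tp s r; apply: (@weaken [::]) => //.
  by apply: proves_closed_subst; apply: D_ax.
- by move=> G p Gp s r; apply: D_hyp; apply: List.in_map.
- by move=> G p q _ IH s r; apply: D_impI; apply: IH.
- by move=> G p q _ IH1 _ IH2 s r; apply: D_impE (IH1 s r) (IH2 s r).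
- by move=> G p _ IH s r; apply: D_dne; apply: IH.
- move=> G p _ IH s r /=; apply: D_all1I.
  have := IH (up1 s) r; rewrite -!map_comp; congr proves.
  by apply: eq_map => q /=; apply: subst_shift1.
- by move=> G p t _ IH s r; rewrite subst_inst1; apply: D_all1E; apply: IH.
- move=> G p _ IH s r /=; apply: D_all2I.
  have := IH s (up2 r); rewrite -!map_comp; congr proves.
  by apply: eq_map => q /=; apply: subst_shift2.
- by move=> G p X _ IH s r; rewrite subst_inst2; apply: D_all2E; apply: IH.
- by move=> G t s r; apply: D_refl.
- move=> G p t u _ IH1 _ IH2 s r; rewrite subst_inst1; apply: D_eq (IH1 s r) _.
  by rewrite -subst_inst1; apply: IH2.
Qed.

(** Renaming y to 0 and every other i to i + 1 acts on G as a shift, since y is fresh for G, and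
    undoes the instantiation in p; this leads to the premise of [D_all1I]. The bound on p is y + 1
    because p lies under one more binder. *)
Lemma gen1 G p y : (forall q, List.In q G -> below1 y q) -> below1 y.+1 p ->
  proves T G (inst1 (Var y) p) -> proves T G (All1 p).
Proof.
move=> HG Hp /(@proves_subst _ _ (fun i => if i == y then Var 0 else Var i.+1) id) H.
apply: D_all1I; move: H; congr proves.
  apply: List.map_ext_in => q /HG; apply => i iy.
  by rewrite ltn_eqF.
rewrite /inst1 subst_comp -[RHS]subst_var; apply: Hp => -[|i] /= iy.
  by rewrite eqxx.
by rewrite ltn_eqF.
Qed.

Lemma gen2 G p y : (forall q, List.In q G -> below2 y q) -> below2 y.+1 p ->
  proves T G (inst2 y p) -> proves T G (All2 p).
Proof.
move=> HG Hp /(@proves_subst _ _ Var (fun i => if i == y then 0 else i.+1)) H.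
apply: D_all2I; move: H; congr proves.
  apply: List.map_ext_in => q /HG; apply => i iy.
  by rewrite ltn_eqF.
rewrite /inst2 subst_comp -[RHS]subst_var; apply: Hp => -[|i] /= iy.
  by rewrite eqxx.
by rewrite ltn_eqF.
Qed.

Lemma exfalso G p : proves T G Bot -> proves T G p.
Proof.
by move=> H; apply: D_dne; apply: D_impI; apply: weaken H => q Hq; right.
Qed.

Lemma raa G p : proves T (Not p :: G) Bot -> proves T G p.
Proof. by move=> H; apply: D_dne; apply: D_impI. Qed.

Lemma hyp0 G p : proves T (p :: G) p.
Proof. by apply: D_hyp; left. Qed.

(** * Consistent contexts and Henkin witnesses *)

Definition consistent G := ~ proves T G Bot.

Lemma consistent_incl G G' : List.incl G G' -> consistent G' -> consistent G.
Proof. by move=> GG' + H; apply; apply: weaken H. Qed.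

Lemma consistent_dec G p : consistent G -> consistent (p :: G) \/ consistent (Not p :: G).
Proof.
move=> cG; case: (pselect (consistent (p :: G))) => [|/contrapT Hp]; first by left.
by right=> Hn; apply: cG; apply: D_impE (D_impI Hp) (raa Hn).
Qed.

(** A variable fresh for the finite context is the witness: refuting its instance would amount to
    deriving [All1 p] by generalization. *)
Lemma consistent_wit1 G p : consistent (Not (All1 p) :: G) ->
  exists t, consistent [:: Not (inst1 t p), Not (All1 p) & G].
Proof.
move=> cG; have [n Hn] := fresh1 (p :: Not (All1 p) :: G).
exists (Var n) => /raa H; apply: cG; apply: (@D_impE _ _ (All1 p)); first exact: hyp0.
apply: gen1 H; first by move=> q Hq; apply: Hn; right.
by apply: (@below1_leq n); last by apply: Hn; left.
Qed.

Lemma consistent_wit2 G p : consistent (Not (All2 p) :: G) ->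
  exists X, consistent [:: Not (inst2 X p), Not (All2 p) & G].
Proof.
move=> cG; have [n Hn] := fresh2 (p :: Not (All2 p) :: G).
exists n => /raa H; apply: cG; apply: (@D_impE _ _ (All2 p)); first exact: hyp0.
apply: gen2 H; first by move=> q Hq; apply: Hn; right.
by apply: (@below2_leq n); last by apply: Hn; left.
Qed.

Definition henkin_step p G G' :=
  [/\ List.incl G G', List.In p G' \/ List.In (Not p) G',
      forall q, p = Not (All1 q) -> List.In p G' ->
        exists t, List.In (Not (inst1 t q)) G'
    & forall q, p = Not (All2 q) -> List.In p G' ->
        exists X, List.In (Not (inst2 X q)) G'].

Lemma henkin_stepP p G : consistent G -> exists2 G', consistent G' & henkin_step p G G'.
Proof.
move=> cG; have [cp|cp] := pselect (consistent (p :: G)); last first.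
  have cn : consistent (Not p :: G) by case: (consistent_dec p cG).
  (* The witness clauses hold vacuously here: a consistent context that contains [Not p] cannot
     contain p. *)
  exists (Not p :: G) => //; split; [by move=> q Hq; right|by right; left| |] => q Ep Hp;
    by case: cn; apply: (@D_impE _ _ p); [exact: hyp0|apply: D_hyp].
have [[q Ep]|n1] := pselect (exists q, p = Not (All1 q)).
  rewrite Ep in cp *; have [t ct] := consistent_wit1 cp.
  exists [:: Not (inst1 t q), Not (All1 q) & G] => //; split.
  - by move=> ? ?; right; right.
  - by left; right; left.
  - by move=> q' [<-] _; exists t; left.
  - by move=> q' [].
have [[q Ep]|n2] := pselect (exists q, p = Not (All2 q)).
  rewrite Ep in cp *; have [t ct] := consistent_wit2 cp.
  exists [:: Not (inst2 t q), Not (All2 q) & G] => //; split.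
  - by move=> ? ?; right; right.
  - by left; right; left.
  - by move=> q' [].
  - by move=> q' [<-] _; exists t; left.
exists (p :: G) => //; split; first by move=> ? ?; right.
- by left; left.
- by move=> q Eq; case: n1; exists q.
- by move=> q Eq; case: n2; exists q.
Qed.

End Proofs.

(** * Countability of terms and formulas, for the Henkin enumeration *)

Fixpoint term_tree (t : term) : GenTree.tree nat :=
  match t with
  | Var i => GenTree.Node 0 [:: GenTree.Leaf i]
  | Zero => GenTree.Node 1 [::]
  | One => GenTree.Node 2 [::]
  | Add a b => GenTree.Node 3 [:: term_tree a; term_tree b]
  | Mul a b => GenTree.Node 4 [:: term_tree a; term_tree b]
  end.

Fixpoint tree_term (t : GenTree.tree nat) : option term :=
  match t with
  | GenTree.Node 0 [:: GenTree.Leaf i] => Some (Var i)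
  | GenTree.Node 1 [::] => Some Zero
  | GenTree.Node 2 [::] => Some One
  | GenTree.Node 3 [:: a; b] =>
      if (tree_term a, tree_term b) is (Some a, Some b) then Some (Add a b) else None
  | GenTree.Node 4 [:: a; b] =>
      if (tree_term a, tree_term b) is (Some a, Some b) then Some (Mul a b) else None
  | _ => None
  end.

Lemma term_treeK : pcancel term_tree tree_term.
Proof. by elim=> //= a -> b ->. Qed.

HB.instance Definition _ := Countable.copy term (pcan_type term_treeK).

Fixpoint formula_tree (p : formula) : GenTree.tree (term + nat) :=
  match p with
  | EqT a b => GenTree.Node 0 [:: GenTree.Leaf (inl a); GenTree.Leaf (inl b)]
  | LtT a b => GenTree.Node 1 [:: GenTree.Leaf (inl a); GenTree.Leaf (inl b)]
  | MemS a X => GenTree.Node 2 [:: GenTree.Leaf (inl a); GenTree.Leaf (inr X)]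
  | Bot => GenTree.Node 3 [::]
  | Imp p q => GenTree.Node 4 [:: formula_tree p; formula_tree q]
  | All1 p => GenTree.Node 5 [:: formula_tree p]
  | All2 p => GenTree.Node 6 [:: formula_tree p]
  end.

Fixpoint tree_formula (t : GenTree.tree (term + nat)) : option formula :=
  match t with
  | GenTree.Node 0 [:: GenTree.Leaf (inl a); GenTree.Leaf (inl b)] => Some (EqT a b)
  | GenTree.Node 1 [:: GenTree.Leaf (inl a); GenTree.Leaf (inl b)] => Some (LtT a b)
  | GenTree.Node 2 [:: GenTree.Leaf (inl a); GenTree.Leaf (inr X)] => Some (MemS a X)
  | GenTree.Node 3 [::] => Some Bot
  | GenTree.Node 4 [:: a; b] =>
      if (tree_formula a, tree_formula b) is (Some p, Some q) then Some (Imp p q) else None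
  | GenTree.Node 5 [:: a] => omap All1 (tree_formula a)
  | GenTree.Node 6 [:: a] => omap All2 (tree_formula a)
  | _ => None
  end.

Lemma formula_treeK : pcancel formula_tree tree_formula.
Proof. by elim=> //= [p -> q ->|p ->|p ->]. Qed.

HB.instance Definition _ := Countable.copy formula (pcan_type formula_treeK).

(** * Two-sorted structures and satisfaction *)

Record structure := Structure {
  num : Type;
  nset : Type;
  szero : num;
  sone : num;
  sadd : num -> num -> num;
  smul : num -> num -> num;
  slt : num -> num -> Prop;
  smem : num -> nset -> Prop
}.

Section Semantics.
Variable M : structure.

Fixpoint teval (v : nat -> num M) (t : term) : num M :=
  match t with
  | Var i => v i
  | Zero => szero M
  | One => sone M
  | Add a b => sadd (teval v a) (teval v b)
  | Mul a b => smul (teval v a) (teval v b)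
  end.

Fixpoint sat (v : nat -> num M) (w : nat -> nset M) (p : formula) : Prop :=
  match p with
  | EqT a b => teval v a = teval v b
  | LtT a b => slt (teval v a) (teval v b)
  | MemS a X => smem (teval v a) (w X)
  | Bot => False
  | Imp p q => sat v w p -> sat v w q
  | All1 p => forall x, sat (scons x v) w p
  | All2 p => forall X, sat v (scons X w) p
  end.

(* The same with the defined connectives interpreted as those of the metatheory,
   so that it unfolds to a readable statement. *)
Fixpoint holds (v : nat -> num M) (w : nat -> nset M) (p : formula) : Prop :=
  match p with
  | EqT a b => teval v a = teval v b
  | LtT a b => slt (teval v a) (teval v b)
  | MemS a X => smem (teval v a) (w X)
  | Bot => False
  | Imp p q =>
      match q with
      | Bot =>
          match p with
          | All1 (Imp p Bot) => exists x, holds (scons x v) w p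
          | All2 (Imp p Bot) => exists X, holds v (scons X w) p
          | Imp p (Imp q Bot) => holds v w p /\ holds v w q
          | _ => ~ holds v w p
          end
      | _ => holds v w p -> holds v w q
      end
  | All1 p => forall x, holds (scons x v) w p
  | All2 p => forall X, holds v (scons X w) p
  end.

Let agree p := forall v w, holds v w p <-> sat v w p.

(** The clauses of [holds] inspect several levels of a formula at once, so an induction hypothesis
    about immediate subformulas does not suffice; agreement is carried for all subformulas. *)
Fixpoint agree_sub p : Prop :=
  agree p /\
  match p with
  | Imp p q => agree_sub p /\ agree_sub q
  | All1 p | All2 p => agree_sub p
  | _ => True
  end.

Lemma agree_subP p : agree_sub p.
Proof.
have sub q : agree_sub q -> agree q by case: q => [? ?|? ?|? ?||? ?|?|?] [].
have imp (P P' Q Q' : Prop) : (P <-> P') -> (Q <-> Q') -> (P -> Q) <-> (P' -> Q').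
  by move=> [? ?] [? ?]; tauto.
have ex1 q : agree q -> forall v w,
    (exists x, holds (scons x v) w q) <-> ((forall x, sat (scons x v) w q -> False) -> False).
  move=> Hq v w; split=> [[x /Hq H] /(_ x)//|H]; apply: contrapT => N.
  by apply: H => x /Hq H; apply: N; exists x.
have ex2 q : agree q -> forall v w,
    (exists x, holds v (scons x w) q) <-> ((forall x, sat v (scons x w) q -> False) -> False).
  move=> Hq v w; split=> [[x /Hq H] /(_ x)//|H]; apply: contrapT => N.
  by apply: H => x /Hq H; apply: N; exists x.
have cj q r : agree q -> agree r -> forall v w,
    (holds v w q /\ holds v w r) <-> ((sat v w q -> sat v w r -> False) -> False).
  move=> Hq Hr v w; split=> [[/Hq H1 /Hr H2] /(_ H1 H2)//|H]; apply: contrapT => N.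
  by apply: H => /Hq H1 /Hr H2; apply: N.
elim: p => [a b|a b|a X||p IHp q IHq|p IHp|p IHp]; (split; [move=> v w|by []]) => //.
- have [Hp Hq] := (sub _ IHp v w, sub _ IHq v w).
  case: q IHq Hq => [a b|a b|a X||q1 q2|q|q] IHq Hq; try exact: (imp _ _ _ _ Hp Hq).
  case: p IHp Hp => [a b|a b|a X||p1 p2|p|p] IHp Hp; try exact: (imp _ _ _ _ Hp Hq).
  + case: p2 IHp Hp => [a b|a b|a X||p3 p4|p2|p2] IHp Hp; try exact: (imp _ _ _ _ Hp Hq).
    case: p4 IHp Hp => [a b|a b|a X||p5 p6|p4|p4] IHp Hp; try exact: (imp _ _ _ _ Hp Hq).
    by apply: cj; apply: sub; move: IHp => /= [_ [? [_ []]]].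
  + case: p IHp Hp => [a b|a b|a X||p1 p2|p|p] IHp Hp; try exact: (imp _ _ _ _ Hp Hq).
    case: p2 IHp Hp => [a b|a b|a X||p3 p4|p2|p2] IHp Hp; try exact: (imp _ _ _ _ Hp Hq).
    by apply: ex1; apply: sub; move: IHp => /= [_ [_ []]].
  + case: p IHp Hp => [a b|a b|a X||p1 p2|p|p] IHp Hp; try exact: (imp _ _ _ _ Hp Hq).
    case: p2 IHp Hp => [a b|a b|a X||p3 p4|p2|p2] IHp Hp; try exact: (imp _ _ _ _ Hp Hq).
    by apply: ex2; apply: sub; move: IHp => /= [_ [_ []]].
- by split=> H x; apply/(sub _ IHp); apply: H.
- by split=> H x; apply/(sub _ IHp); apply: H.
Qed.

Lemma holdsE v w p : holds v w p <-> sat v w p.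
Proof.
by have := agree_subP p; case: p => [? ?|? ?|? ?||? ?|?|?] [].
Qed.

Lemma teval_subst v s t : teval v (tsubst s t) = teval (teval v \o s) t.
Proof. by elim: t => //= a -> b ->. Qed.

Lemma sat_subst v w s r p : sat v w (subst s r p) <-> sat (teval v \o s) (w \o r) p.
Proof.
elim: p v w s r => //= [a b|a b|a X|p IHp q IHq|p IH|p IH] v w s r.
- by rewrite !teval_subst.
- by rewrite !teval_subst.
- by rewrite teval_subst.
- by split=> H /IHp /H /IHq.
- have E x : teval (scons x v) \o up1 s = scons x (teval v \o s).
    by apply: funext => -[|i] //=; rewrite /tlift teval_subst.
  split=> H x; first by rewrite -E; apply/IH.
  by apply/IH; rewrite E.
- have E x : scons x w \o up2 r = scons x (w \o r) by apply: funext; case.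
  split=> H x; first by rewrite -E; apply/IH.
  by apply/IH; rewrite E.
Qed.

Definition models (T : formula -> Prop) := forall p, T p -> forall v w, sat v w p.

End Semantics.

(** * Maximal consistent theories with witnesses *)

Section Completeness.
Variables (T : formula -> Prop) (p0 : formula).
Hypothesis cp0 : consistent T [:: Not p0].

Lemma henkin_seq_ex : exists G : nat -> seq formula,
  [/\ List.In (Not p0) (G 0), forall n, consistent T (G n),
      forall n, List.incl (G n) (G n.+1)
    & forall p, exists n, henkin_step p (G n) (G n.+1)].
Proof.
have step (n : nat) (G : {G | consistent T G}) : {G' : {G | consistent T G} |
    List.incl (sval G) (sval G') /\
    forall p, unpickle n = Some p -> henkin_step p (sval G) (sval G')}.
  apply: cid; case: G => G cG; case E: (unpickle n) => [p|]; last first.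
    by exists (exist _ G cG); split=> // q.
  have [G' cG' H] := henkin_stepP p cG; exists (exist _ G' cG'); split; first by case: H.
  by move=> q [<-].
pose H := fix H n := if n is m.+1 then sval (step m (H m)) else exist _ _ cp0.
exists (fun n => sval (H n)); split=> [|n|n|p]; first by left.
- exact: svalP (H n).
- exact: (svalP (step n (H n))).1.
- by exists (pickle p); apply: (svalP (step _ (H _))).2; rewrite pickleK.
Qed.

(** D is the union of the Henkin chain. A derivation uses only a finite context, which lies in a
    single stage of the chain, so consistency passes from the stages to the union. *)
Lemma henkin_theory_ex : exists D : formula -> Prop,
  [/\ D (Not p0),
      forall G p, (forall q, List.In q G -> D q) -> proves T G p -> D p,
      forall p, D (Not p) <-> ~ D p,
      forall p, (forall t, D (inst1 t p)) -> D (All1 p)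
    & forall p, (forall X, D (inst2 X p)) -> D (All2 p)].
Proof.
have [G [G0 cG sG hG]] := henkin_seq_ex.
have mG m n : m <= n -> List.incl (G m) (G n).
  move=> /subnK <-; elim: (n - m) => [|d IH]; first exact: List.incl_refl.
  exact: List.incl_tran IH (sG _).
pose D p := exists n, List.In p (G n).
have Dfin E : (forall q, List.In q E -> D q) -> exists n, List.incl E (G n).
  elim: E => [|q E IH] H; first by exists 0.
  have [n Hn] := IH (fun r Hr => H r (or_intror Hr)).
  have [m Hm] := H q (or_introl erefl); exists (maxn m n) => r /= [<-|/Hn].
    by apply: mG Hm; rewrite leq_maxl.
  by apply: mG; rewrite leq_maxr.
have Dcons E : (forall q, List.In q E -> D q) -> consistent T E.
  by move=> /Dfin[n Hn]; apply: consistent_incl Hn (cG n).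
have Ddec p : D p \/ D (Not p).
  by have [n [_ [H|H] _ _]] := hG p; [left|right]; exists n.+1.
have Dded E p : (forall q, List.In q E -> D q) -> proves T E p -> D p.
  move=> HE Hp; case: (Ddec p) => // Hn.
  have /Dcons[] : forall q, List.In q (Not p :: E) -> D q by move=> q /= [<-|/HE].
  apply: (@D_impE _ _ p); first exact: hyp0.
  by apply: weaken Hp => ? ?; right.
have Dn p : D (Not p) <-> ~ D p.
  split=> [Hn Hp|Hp]; last by case: (Ddec p).
  have /Dcons[] : forall q, List.In q [:: Not p; p] -> D q.
    by move=> q /= [<-|[<-|[]]].
  by apply: (@D_impE _ _ p); apply: D_hyp; [left|right; left].
exists D; split=> //; first by exists 0.
- move=> p Hp; case: (Ddec (All1 p)) => // Hn; have [n [_ [H|H] H1 _]] := hG (Not (All1 p)).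
    by have [t Ht] := H1 p erefl H; case/Dn: (ex_intro _ n.+1 Ht : D _).
  by have /Dn : D (Not (Not (All1 p))) by exists n.+1.
- move=> p Hp; case: (Ddec (All2 p)) => // Hn; have [n [_ [H|H] _ H1]] := hG (Not (All2 p)).
    by have [t Ht] := H1 p erefl H; case/Dn: (ex_intro _ n.+1 Ht : D _).
  by have /Dn : D (Not (Not (All2 p))) by exists n.+1.
Qed.

End Completeness.

(** * The term model of a Henkin theory *)

Section TermModel.
Variables (T D : formula -> Prop).
Hypothesis Dded : forall G p, (forall q, List.In q G -> D q) -> proves T G p -> D p.
Hypothesis Dn : forall p, D (Not p) <-> ~ D p.
Hypothesis D1 : forall p, (forall t, D (inst1 t p)) -> D (All1 p).
Hypothesis D2 : forall p, (forall X, D (inst2 X p)) -> D (All2 p).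

Let teq (t u : term) : Prop := D (EqT t u).
(** Equality of numbers belongs to the language and must become true equality, whence classes of
    provably equal terms. The language has no equality between sets, so that set variables can stand
    for themselves. *)
Let N := {P : term -> Prop | exists t, P = teq t}.
Let cls t : N := exist _ (teq t) (ex_intro _ t erefl).

Lemma Dded1 p q : D p -> proves T [:: p] q -> D q.
Proof. by move=> Dp; apply: Dded => r /= [<-|[]]. Qed.

Lemma Dded2 p q r : D p -> D q -> proves T [:: p; q] r -> D r.
Proof. by move=> Dp Dq; apply: Dded => s /= [<-|[<-|[]]]. Qed.

Lemma D_rewrite p t u : D (EqT t u) -> D (inst1 t p) -> D (inst1 u p).
Proof.
move=> E H; apply: (Dded2 E H).
by apply: D_eq; apply: D_hyp; [left|right; left].
Qed.

Lemma inst1_tlift t u : tsubst (scons t Var) (tlift 1 u) = u.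
Proof. by rewrite /tlift tsubst_comp tsubst_var. Qed.

Lemma D_eq_refl t : D (EqT t t).
Proof. by apply: (@Dded [::]) => //; apply: D_refl. Qed.

Lemma D_eq_sym t u : D (EqT t u) -> D (EqT u t).
Proof.
move=> E; have := @D_rewrite (EqT (Var 0) (tlift 1 t)) t u E.
by rewrite /inst1 /= !inst1_tlift; apply; apply: D_eq_refl.
Qed.

Lemma D_eq_trans t u v : D (EqT t u) -> D (EqT u v) -> D (EqT t v).
Proof.
move=> E F; have := @D_rewrite (EqT (tlift 1 t) (Var 0)) u v F.
by rewrite /inst1 /= !inst1_tlift; apply.
Qed.

Lemma clsP t u : cls t = cls u <-> D (EqT t u).
Proof.
split=> [[E]|E]; first by have : teq t u by rewrite E; apply: D_eq_refl.
apply: eq_exist; apply: funext => v; apply: propext; rewrite /teq; split.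
  by apply: D_eq_trans; apply: D_eq_sym.
exact: D_eq_trans.
Qed.

Let repr (x : N) : term := sval (cid (svalP x)).

Lemma reprK x : cls (repr x) = x.
Proof.
apply: eq_sig_hprop => [*|]; first exact: Prop_irrelevance.
by rewrite /= /repr; case: (cid (svalP x)) => /= t ->.
Qed.

Lemma repr_cls t : D (EqT t (repr (cls t))).
Proof. by apply/clsP; rewrite reprK. Qed.

Definition term_model : structure := {|
  num := N; nset := nat; szero := cls Zero; sone := cls One;
  sadd x y := cls (Add (repr x) (repr y));
  smul x y := cls (Mul (repr x) (repr y));
  slt x y := D (LtT (repr x) (repr y));
  smem x X := D (MemS (repr x) X) |}.

Lemma D_eq2 (f : term -> term -> term) :
  (forall s t u, tsubst s (f t u) = f (tsubst s t) (tsubst s u)) ->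
  forall t t' u u', D (EqT t t') -> D (EqT u u') -> D (EqT (f t u) (f t' u')).
Proof.
move=> Hf t t' u u' E E'.
have := @D_rewrite (EqT (tlift 1 (f t u)) (f (Var 0) (tlift 1 u))) t t' E.
rewrite /inst1 /= !Hf !inst1_tlift /= => /(_ (D_eq_refl _)) E1.
have := @D_rewrite (EqT (tlift 1 (f t u)) (f (tlift 1 t') (Var 0))) u u' E'.
by rewrite /inst1 /= !Hf !inst1_tlift /=; apply.
Qed.

Lemma teval_term_model (s : nat -> term) t :
  teval (M := term_model) (cls \o s) t = cls (tsubst s t).
Proof.
by elim: t => //= a -> b ->; apply/clsP;
   apply: D_eq2 => //; apply: D_eq_sym; apply: repr_cls.
Qed.

Lemma D_slt t u : D (LtT (repr (cls t)) (repr (cls u))) <-> D (LtT t u).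
Proof.
have key t' u' v w : D (EqT t' v) -> D (EqT u' w) -> D (LtT t' u') -> D (LtT v w).
  move=> /(@D_rewrite (LtT (Var 0) (tlift 1 u'))) + /(@D_rewrite (LtT (tlift 1 v) (Var 0))).
  by rewrite /inst1 /= !inst1_tlift => H1 H2 H; apply: H2 (H1 H).
split; apply: key; do ?[exact: repr_cls]; exact: D_eq_sym (repr_cls _).
Qed.

Lemma D_smem t X : D (MemS (repr (cls t)) X) <-> D (MemS t X).
Proof.
split; last exact: (@D_rewrite (MemS (Var 0) X)) (repr_cls t).
exact: (@D_rewrite (MemS (Var 0) X)) (D_eq_sym (repr_cls t)).
Qed.

Lemma D_imp p q : D (Imp p q) <-> (D p -> D q).
Proof.
split=> [H Hp|H].
  by apply: (Dded2 H Hp); apply: (@D_impE _ _ p); apply: D_hyp; [left|right; left].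
have [/H Hq|/Dn Hp] := pselect (D p); first by apply: (Dded1 Hq); apply: D_impI; apply: D_hyp; right; left.
apply: (Dded1 Hp); apply: D_impI; apply: exfalso.
by apply: (@D_impE _ _ p); apply: D_hyp; [right; left|left].
Qed.

Lemma D_bot : ~ D Bot.
Proof.
apply/Dn; apply: (@Dded [::]) => //; apply: D_impI; exact: hyp0.
Qed.

Lemma D_all1 p : D (All1 p) <-> forall t, D (inst1 t p).
Proof.
split=> [H t|]; last exact: D1.
by apply: (Dded1 H); apply: D_all1E; apply: hyp0.
Qed.

Lemma D_all2 p : D (All2 p) <-> forall X, D (inst2 X p).
Proof.
split=> [H t|]; last exact: D2.
by apply: (Dded1 H); apply: D_all2E; apply: hyp0.
Qed.

(** The truth lemma, for all substitutions at once: at a quantifier, an element of the model is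
    replaced by a term that represents it, which extends s. *)
Lemma sat_term_model (s : nat -> term) (r : nat -> nat) p :
  sat (M := term_model) (cls \o s) r p <-> D (subst s r p).
Proof.
elim: p s r => [a b|a b|a X||p IHp q IHq|p IH|p IH] s r.
- by rewrite /= !teval_term_model clsP.
- by rewrite /= !teval_term_model D_slt.
- by rewrite /= !teval_term_model D_smem.
- by split=> // /D_bot.
- by rewrite /= D_imp; split=> H /IHp /H /IHq.
- rewrite /= D_all1; split=> H x.
    rewrite inst1_subst; apply/IH; move: (H (cls x)); congr sat.
    by apply: funext; case.
  move: (H (repr x)); rewrite inst1_subst => /IH; congr sat.
  by apply: funext => -[|i] //=; rewrite reprK.
- by rewrite /= D_all2; split=> H X; move: (H X); rewrite inst2_subst => /IH.
Qed.

Lemma term_model_models : models term_model T.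
Proof.
move=> p Tp v w.
have -> : v = cls \o (repr \o v) by apply: funext => i /=; rewrite reprK.
apply/sat_term_model; apply: (@Dded [::]) => //.
by apply: proves_closed_subst; apply: D_ax.
Qed.

End TermModel.

Theorem completeness T p :
  (forall M, models M T -> forall v w, holds (M := M) v w p) -> proves T [::] p.
Proof.
move=> H; apply: contrapT => np.
have c : consistent T [:: Not p] by move=> /raa.
have [D [D0 Dded Dn D1 D2]] := henkin_theory_ex c.
(* Free variables of p denote themselves: number variables their own classes, set variables their
   indices. *)
have := H _ (term_model_models Dded Dn D1 D2) _ (fun i => i).
move=> /(_ _)/holdsE/(sat_term_model Dded Dn D1 D2 Var).
by rewrite subst_var; apply/Dn.
Qed.

(** * Models of RCA_0 *)

Definition BAll (t : term) (p : formula) : formula := (All1 ('v_0 < tlift 1 t ==>> p))%F.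
Definition BEx (t : term) (p : formula) : formula := (Ex1 ('v_0 < tlift 1 t /\ p))%F.

Lemma tlift_subst s t : tsubst (up1 s) (tlift 1 t) = tlift 1 (tsubst s t).
Proof. by rewrite /tlift !tsubst_comp. Qed.

Lemma Delta0_subst p s r : Delta0 p -> Delta0 (subst s r p).
Proof.
move=> H; elim: H s r => {p} //=; try by constructor.
- by move=> t p _ IH s r; rewrite tlift_subst; apply: Delta0_All; apply: IH.
- by move=> t p _ IH s r; rewrite tlift_subst; apply: Delta0_Ex; apply: IH.
Qed.

(* [Delta0_Imp] comes last, since [Ex1] unfolds to an implication. *)
Ltac delta0 := repeat first
  [ apply: Delta0_Eq | apply: Delta0_Lt | apply: Delta0_Mem | apply: Delta0_Bot
  | apply: Delta0_All | apply: Delta0_Ex | apply: Delta0_Imp ].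

Section Arithmetic.
Variable M : structure.
Hypothesis MQ : models M RCA0.
Variable X0 : nset M.

Declare Scope num_scope.
Local Notation N := (num M).
Bind Scope num_scope with num.
Local Notation "0" := (szero M) : num_scope.
Local Notation "1" := (sone M) : num_scope.
Local Notation "x + y" := (sadd x y) : num_scope.
Local Notation "x * y" := (smul x y) : num_scope.
Local Notation "x < y" := (slt x y) : num_scope.
Local Open Scope num_scope.
Implicit Types (x y z : N) (vs : seq N) (ws : seq (nset M)).

(** The parameters of a scheme instance are given as finite lists, padded by a default value. For
    sets the default is [X0], as a structure has no distinguished set. *)
Definition env vs : nat -> N := nth 0 vs.
Definition sets ws : nat -> nset M := nth X0 ws.

Lemma holds_subst (v : nat -> N) w s r p : holds v w (subst s r p) <-> holds (teval v \o s) (w \o r) p.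
Proof. by rewrite !holdsE; apply: sat_subst. Qed.

Lemma axiomP p : RCA0 p -> forall v w, holds (M := M) v w p.
Proof. by move=> /MQ H v w; apply/holdsE. Qed.

Lemma Sigma1_ind (P : N -> Prop) vs ws p : Delta0 p ->
  (forall x, P x <-> exists u, holds (scons u (scons x (env vs))) (sets ws) p) ->
  P 0 -> (forall x, P x -> P (x + 1)) -> forall x, P x.
Proof.
move=> Dp PE P0 PS x.
have := MQ (Sigma1_induction (Sigma1_Ex Dp)) (env vs) (sets ws).
have E t (v : nat -> N) : teval v \o scons t Var = scons (teval v t) v.
  by apply: funext; case.
move=> /= H; apply/PE; apply/(holdsE _ _ (Ex1 p)); apply: H.
- apply/(sat_subst _ _ (scons Zero Var) id (Ex1 p)); rewrite E.
  by apply/holdsE/PE.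
- move=> y /(holdsE (scons y (env vs)) (sets ws) (Ex1 p))/PE/PS/PE H.
  apply/(sat_subst _ _ _ id (Ex1 p)).
  have -> : teval (scons y (env vs)) \o
     scons ('v_0 + 1)%T (fun i => Var i.+1) = scons (y + 1) (env vs).
    by apply: funext; case.
  exact/holdsE.
Qed.

(** A vacuous existential quantifier makes p Sigma^0_1; its variables are shifted to make room for
    it. *)
Lemma Delta0_ind (P : N -> Prop) vs ws p : Delta0 p ->
  (forall x, P x <-> holds (scons x (env vs)) (sets ws) p) ->
  P 0 -> (forall x, P x -> P (x + 1)) -> forall x, P x.
Proof.
move=> Dp PE; apply: (Sigma1_ind (vs := vs) (ws := ws) (Delta0_subst (fun i => 'v_i.+1)%F id Dp)).
move=> x; rewrite PE; split=> [H|[u /holds_subst//]].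
by exists x; apply/holds_subst.
Qed.

Lemma Delta1_compr (P Q : N -> N -> Prop) vs ws p q : Delta0 p -> Delta0 q ->
  (forall u x, P u x <-> holds (scons u (scons x (env vs))) (sets ws) p) ->
  (forall u x, Q u x <-> holds (scons u (scons x (env vs))) (sets ws) q) ->
  (forall x, (exists u, P u x) <-> (forall u, Q u x)) ->
  exists X : nset M, forall x, smem x X <-> exists u, P u x.
Proof.
move=> Dp Dq HP HQ E.
have EP x : (exists u, P u x) <-> holds (scons x (env vs)) (sets ws) (Ex1 p).
  by split=> -[u /HP Hu]; exists u.
have EQ x : (forall u, Q u x) <-> holds (scons x (env vs)) (sets ws) (All1 q).
  by split=> H u; apply/HQ.
have /holdsE := MQ (Delta1_comprehension (Sigma1_Ex Dp) (Pi1_All Dq)) (env vs) (sets ws).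
case=> [x|X HX]; first by split=> [/EP/E/EQ|/EQ/E/EP].
exists X => x; rewrite EP; have /= := HX x.
have /= := holds_subst (scons x (env vs)) (scons X (sets ws)) Var succn (Ex1 p).
by move=> H1 [H2 H3]; split=> [/H2/H1|/H1/H3].
Qed.

Lemma Delta0_compr (P : N -> Prop) vs ws p : Delta0 p ->
  (forall x, P x <-> holds (scons x (env vs)) (sets ws) p) ->
  exists X : nset M, forall x, smem x X <-> P x.
Proof.
move=> Dp HP.
have Dq := Delta0_subst (fun i => 'v_i.+1)%F id Dp.
have E u x : P x <-> holds (scons u (scons x (env vs))) (sets ws) (subst (fun i => 'v_i.+1)%F id p).
  by rewrite HP; apply: iff_sym; apply: holds_subst.
have [|X HX] := Delta1_compr (vs := vs) (ws := ws) Dq Dq E E.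
  by move=> x; split=> [[u ?] ?|/(_ x)]; last by exists x.
by exists X => x; rewrite HX; split=> [[]//|]; exists x.
Qed.

(* These tactics read the predicate off the goal and compare it with [holds] of the given formula by
   conversion alone. Statements proved in this way therefore follow their formula connective by
   connective, redundant bounds on quantifiers included. *)
Tactic Notation "delta0_ind" uconstr(vs) uconstr(ws) uconstr(p) :=
  refine (@Delta0_ind _ vs ws p _ _ _ _); [by delta0|by move=> ?; exact: iff_refl| |].
Tactic Notation "delta0_compr" uconstr(vs) uconstr(ws) uconstr(p) :=
  refine (@Delta0_compr _ vs ws p _ _); [by delta0|by move=> ?; exact: iff_refl].
Tactic Notation "delta1_compr" uconstr(Q) uconstr(vs) uconstr(ws) uconstr(p) uconstr(q) :=
  refine (@Delta1_compr _ Q vs ws p q _ _ _ _ _);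
  [by delta0|by delta0|by move=> ? ?; exact: iff_refl|by move=> ? ?; exact: iff_refl|].
Tactic Notation "sigma1_ind" uconstr(vs) uconstr(ws) uconstr(p) :=
  refine (@Sigma1_ind _ vs ws p _ _ _ _); [by delta0|by move=> ?; exact: iff_refl| |].

(** * The ordered semiring of numbers of the model *)

Lemma addm0 x : x + 0 = x. Proof. exact: (axiomP Q_4 (env [:: x]) (sets [::])). Qed.
Lemma addmS x y : x + (y + 1) = (x + y) + 1.
Proof. exact: (axiomP Q_5 (env [:: x; y]) (sets [::])). Qed.
Lemma mulm0 x : x * 0 = 0. Proof. exact: (axiomP Q_6 (env [:: x]) (sets [::])). Qed.
Lemma mulmS x y : x * (y + 1) = x * y + x.
Proof. exact: (axiomP Q_7 (env [:: x; y]) (sets [::])). Qed.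
Lemma succ_neq0 x : x + 1 <> 0.
Proof. exact: (axiomP Q_1 (env [:: x]) (sets [::])). Qed.
Lemma succ_inj x y : x + 1 = y + 1 -> x = y.
Proof. exact: (axiomP Q_2 (env [:: x; y]) (sets [::])). Qed.
Lemma pred_ex x : x = 0 \/ exists y, x = y + 1.
Proof.
have := axiomP Q_3 (env [:: x]) (sets [::]).
by rewrite /Or /= => H; case: (pselect (x = 0)) => [|/H]; [left|right].
Qed.
Lemma ltm_ex x y : x < y <-> exists z, z + (x + 1) = y.
Proof. exact: (axiomP Q_8 (env [:: x; y]) (sets [::])). Qed.

Lemma add0m x : 0 + x = x.
Proof.
move: x; delta0_ind [::] [::] (0 + 'v_0 = 'v_0)%F.
  exact: addm0.
by move=> y E; rewrite addmS E.
Qed.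

Lemma addSm x y : (x + 1) + y = (x + y) + 1.
Proof.
move: y; delta0_ind [:: x] [::] (('v_1 + 1) + 'v_0 = ('v_1 + 'v_0) + 1)%F.
  by rewrite !addm0.
by move=> z E; rewrite !addmS E.
Qed.

Lemma addmC x y : x + y = y + x.
Proof.
move: y; delta0_ind [:: x] [::] ('v_1 + 'v_0 = 'v_0 + 'v_1)%F.
  by rewrite addm0 add0m.
by move=> z E; rewrite addmS addSm E.
Qed.

Lemma addmA x y z : x + (y + z) = (x + y) + z.
Proof.
move: z; delta0_ind [:: x; y] [::] ('v_1 + ('v_2 + 'v_0) = ('v_1 + 'v_2) + 'v_0)%F.
  by rewrite !addm0.
by move=> t E; rewrite !addmS E.
Qed.

Lemma mul0m x : 0 * x = 0.
Proof.
move: x; delta0_ind [::] [::] (0 * 'v_0 = 0)%F.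
  exact: mulm0.
by move=> y E; rewrite mulmS E addm0.
Qed.

Lemma mulSm x y : (x + 1) * y = x * y + y.
Proof.
move: y; delta0_ind [:: x] [::] (('v_1 + 1) * 'v_0 = 'v_1 * 'v_0 + 'v_0)%F.
  by rewrite !mulm0 addm0.
move=> z E; rewrite !mulmS E addmS -!addmA; congr (_ + _).
by rewrite (addmC z (x + 1)) -addmA (addmC 1).
Qed.

Lemma mulmC x y : x * y = y * x.
Proof.
move: y; delta0_ind [:: x] [::] ('v_1 * 'v_0 = 'v_0 * 'v_1)%F.
  by rewrite mulm0 mul0m.
by move=> z E; rewrite mulmS mulSm E.
Qed.

Lemma mulmDr x y z : x * (y + z) = x * y + x * z.
Proof.
move: z; delta0_ind [:: x; y] [::] ('v_1 * ('v_2 + 'v_0) = 'v_1 * 'v_2 + 'v_1 * 'v_0)%F.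
  by rewrite mulm0 !addm0.
by move=> t E; rewrite addmS !mulmS E addmA.
Qed.

Lemma mulmA x y z : x * (y * z) = (x * y) * z.
Proof.
move: z; delta0_ind [:: x; y] [::] ('v_1 * ('v_2 * 'v_0) = ('v_1 * 'v_2) * 'v_0)%F.
  by rewrite !mulm0.
by move=> t E; rewrite !mulmS mulmDr E.
Qed.

Lemma mul1m x : 1 * x = x.
Proof. by rewrite -[1]add0m mulSm mul0m add0m. Qed.

Lemma num_semiring : semi_ring_theory 0 1 (@sadd M) (@smul M) (@eq N).
Proof.
constructor; do ?[exact: add0m|exact: addmC|exact: addmA|exact: mul1m|exact: mul0m
  |exact: mulmC|exact: mulmA].
by move=> x y z; rewrite mulmC mulmDr !(mulmC z).
Qed.
Add Ring num_ring : num_semiring.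

Lemma addmI z x y : x + z = y + z -> x = y.
Proof.
move: z; delta0_ind [:: x; y] [::] ('v_1 + 'v_0 = 'v_2 + 'v_0 ==>> 'v_1 = 'v_2)%F.
  by rewrite !addm0.
by move=> z E; rewrite !addmS => /succ_inj.
Qed.

Lemma addm_eq0 x y : x + y = 0 -> x = 0.
Proof. by have [->|[z ->]] := pred_ex y; [rewrite addm0|rewrite addmS => /succ_neq0]. Qed.

Definition lem x y := exists z, x + z = y.
Local Notation "x <= y" := (lem x y) : num_scope.

Lemma ltmE x y : x < y <-> x + 1 <= y.
Proof. by rewrite ltm_ex; split=> -[z Hz]; exists z; rewrite -Hz; ring. Qed.

Lemma ltmS x y : x < y + 1 <-> x <= y.
Proof.
rewrite ltmE; split=> -[z Hz]; exists z; last by rewrite -Hz; ring.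
by apply: (@addmI 1); rewrite -Hz; ring.
Qed.

Lemma lem0 x : 0 <= x. Proof. by exists x; ring. Qed.
Lemma lemm x : x <= x. Proof. by exists 0; ring. Qed.
Hint Resolve lem0 lemm : core.
Lemma lem_addr x y : x <= x + y. Proof. by exists y. Qed.
Lemma lem_addl x y : x <= y + x. Proof. by exists y; ring. Qed.
Hint Resolve lem_addr lem_addl : core.

Lemma lem_trans y x z : x <= y -> y <= z -> x <= z.
Proof. by move=> [a <-] [b <-]; exists (a + b); ring. Qed.

Lemma lem_anti x y : x <= y -> y <= x -> x = y.
Proof.
move=> [a <-] [b H]; have /addm_eq0 -> : a + b = 0; last by ring.
by apply: (@addmI x); rewrite add0m -[RHS]H; ring.
Qed.

Lemma lem_total x y : x <= y \/ y <= x.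
Proof.
(* One witness covers both alternatives, because the induction formula must have a single leading
   existential quantifier. *)
suff [z H] : exists z, ~ x + z = y -> y + z = x.
  by have [E|/H E] := pselect (x + z = y); [left|right]; exists z.
move: y; sigma1_ind [:: x] [::] (~ 'v_2 + 'v_0 = 'v_1 ==>> 'v_1 + 'v_0 = 'v_2)%F.
  by exists x => _; ring.
move=> y [z Hz]; have [<-|/Hz <-] := pselect (x + z = y).
  by exists (z + 1); case; ring.
have [->|[t ->]] := pred_ex z; first by exists 1; case; ring.
by exists t => _; ring.
Qed.

Lemma ltm_irr x : ~ x < x.
Proof.
by move=> /ltm_ex[z H]; apply: (@succ_neq0 z); apply: (@addmI x); rewrite add0m -[RHS]H; ring.
Qed.

Lemma ltmNge x y : ~ x < y <-> y <= x.
Proof.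
split=> [H|H /ltmE H']; last by apply: (@ltm_irr x); apply/ltmE; apply: lem_trans H' H.
case: (lem_total y x) => // -[z E]; have [Z|[t T]] := pred_ex z.
  by rewrite -E Z; exists 0; ring.
by case: H; apply/ltm_ex; exists t; rewrite -E T; ring.
Qed.

Lemma ltmP x y : x < y \/ y <= x.
Proof. by have [|/ltmNge] := pselect (x < y); [left|right]. Qed.

Lemma ltm_ltm x y : x < y \/ x = y \/ y < x.
Proof.
have [|H] := ltmP x y; first by left.
have [|H'] := ltmP y x; first by right; right.
by right; left; apply: lem_anti.
Qed.

Lemma ltmW x y : x < y -> x <= y.
Proof. by move=> /ltmE; apply: lem_trans; exists 1; ring. Qed.

Lemma lem_ltm_trans y x z : x <= y -> y < z -> x < z.
Proof. by move=> [a <-] /ltmE[b <-]; apply/ltmE; exists (a + b); ring. Qed.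

Lemma ltm_lem_trans y x z : x < y -> y <= z -> x < z.
Proof. by move=> /ltmE H1 H2; apply/ltmE; apply: lem_trans H1 H2. Qed.

Lemma ltm_trans y x z : x < y -> y < z -> x < z.
Proof. by move=> /ltmW; apply: lem_ltm_trans. Qed.

Lemma ltmSm x : x < x + 1. Proof. by apply/ltmS. Qed.
Hint Resolve ltmSm : core.

Lemma ltm0 x : ~ x < 0. Proof. by apply/ltmNge. Qed.

Lemma lem_eqVlt x y : x <= y <-> x = y \/ x < y.
Proof.
split=> [H|[->//|/ltmW//]].
by have [|H'] := ltmP x y; [right|left; apply: lem_anti].
Qed.

Lemma lem_add x y z t : x <= y -> z <= t -> x + z <= y + t.
Proof. by move=> [a <-] [b <-]; exists (a + b); ring. Qed.

Lemma lem_mul x y z t : x <= y -> z <= t -> x * z <= y * t.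
Proof. by move=> [a <-] [b <-]; exists (x * b + a * z + a * b); ring. Qed.

Lemma lem_sqr x : x <= x * x.
Proof. by have [->|[y ->]] := pred_ex x; [|exists ((y + 1) * y); ring]. Qed.

(** * Pairing *)

Definition pr x y : N := (x + y) * (x + y) + x.

Lemma pr_lel x y : x <= pr x y.
Proof. exact: lem_addl. Qed.

Lemma pr_ler x y : y <= pr x y.
Proof. by apply: lem_trans (lem_addr _ _); apply: lem_trans (lem_sqr _). Qed.

Lemma pr_mono x y x' y' : x <= x' -> y <= y' -> pr x y <= pr x' y'.
Proof. by move=> Hx Hy; do ?[apply: lem_add|apply: lem_mul]. Qed.

(** The pairs with sum n lie between n^2 and n^2 + n, hence below (n + 1)^2. *)
Lemma pr_lt x y x' y' : x + y < x' + y' -> pr x y < pr x' y'.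
Proof.
move=> /ltmE H; apply: (@ltm_lem_trans ((x + y + 1) * (x + y + 1))).
  by apply/ltmE; exists (x + y + y); rewrite /pr; ring.
by apply: lem_trans (lem_addr _ _); apply: lem_mul.
Qed.

Lemma pr_inj x y x' y' : pr x y = pr x' y' -> x = x' /\ y = y'.
Proof.
move=> E; have [/pr_lt|[H|/pr_lt]] := ltm_ltm (x + y) (x' + y'); do ?by rewrite E => /ltm_irr.
have Ex : x = x'.
  apply: (@addmI ((x + y) * (x + y))); move: E; rewrite /pr -H.
  by rewrite ![_ + _ * _]addmC.
by split=> //; apply: (@addmI x); rewrite addmC H Ex addmC.
Qed.

(** The bounded form is what a [Delta0] formula can say. A pair is at least as large as its
    components, so the bounds exclude nothing. *)
Lemma triple_bound (R : N -> N -> N -> Prop) y :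
  (exists i, i < y + 1 /\ exists x, x < y + 1 /\ exists j, j < y + 1 /\ (y = pr (pr i x) j /\ R i x j)) <->
  exists i x j, y = pr (pr i x) j /\ R i x j.
Proof.
split=> [[i [_ [x [_ [j [_ H]]]]]]|[i [x [j [E H]]]]]; exists i; first by exists x, j.
split; first by apply/ltmS; rewrite E; apply: lem_trans (pr_lel _ _) (pr_lel _ _).
exists x; split; first by apply/ltmS; rewrite E; apply: lem_trans (pr_ler _ _) (pr_lel _ _).
by exists j; split=> //; apply/ltmS; rewrite E; apply: pr_ler.
Qed.

Lemma double_bound (R : N -> N -> Prop) y :
  (exists x, x < y + 1 /\ exists j, j < y + 1 /\ (y = pr x j /\ R x j)) <->
  exists x j, y = pr x j /\ R x j.
Proof.
split=> [[x [_ [j [_ H]]]]|[x [j [E H]]]]; exists x; first by exists j.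
split; first by apply/ltmS; rewrite E; apply: pr_lel.
by exists j; split=> //; apply/ltmS; rewrite E; apply: pr_ler.
Qed.

(** * Divisibility and the coding of finite sets by moduli *)

Definition dv x y := exists q, y = x * q.

Lemma dv_mulr x y z : dv x y -> dv x (y * z).
Proof. by move=> [q ->]; exists (q * z); ring. Qed.

Lemma dv_mul x z : dv x (x * z).
Proof. by exists z. Qed.

Lemma dv_add x y z : dv x (y + z) -> dv x y -> dv x z.
Proof.
move=> [r Hr] [q Hq]; have [[t E]|[t E]] := lem_total q r.
  by exists t; apply: (@addmI y); rewrite addmC Hr Hq -E; ring.
suff -> : z = 0 by exists 0; rewrite mulm0.
apply: (@addm_eq0 _ (x * t)); apply: (@addmI (x * r)).
by rewrite [RHS]add0m -[RHS]Hr Hq -E; ring.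
Qed.

(** A substitute for the factorial of B, which would itself require recursion. Bounding the cofactor
    e keeps the induction formula Sigma^0_1. *)
Lemma multiple_ex B : exists m, 0 < m /\ forall d, d < B -> exists e, e < m + 1 /\ (d + 1) * e = m.
Proof.
move: B; sigma1_ind [::] [::] (0 < 'v_0 /\ BAll 'v_1 (BEx ('v_1 + 1) (('v_1 + 1) * 'v_0 = 'v_2)))%F.
  by exists 1; split; [apply/ltmE; exists 0; ring|move=> d /ltm0].
move=> B [m [m0 Hm]]; exists (m * (B + 1)); split.
  by apply: (ltm_lem_trans m0); exists (m * B); ring.
move=> d /ltmS/lem_eqVlt[->|/Hm[e [He E]]].
  by exists m; split; [apply/ltmS; exists (m * B); ring|ring].
exists (e * (B + 1)); split; last by rewrite -E; ring.
by apply/ltmS; apply: lem_mul => //; apply/ltmS.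
Qed.

Definition modulus m x := m * (x + 1) + 1.
(** The condition of the beta function: it makes the moduli m (x + 1) + 1 for x < B pairwise
    coprime, and m > 0 makes them different from 1. *)
Definition good m B := 0 < m /\ forall d, d < B -> dv (d + 1) m.

Lemma good_ex B : exists m, good m B.
Proof.
have [m [m0 H]] := multiple_ex B; exists m; split=> // d /H[e [_ <-]].
exact: dv_mul.
Qed.

(* Up to sign, (y + 1) p_x - (x + 1) p_y = y - x, which divides m, and m is
   invertible modulo p_x; this avoids gcds. *)
Lemma modulus_dvd m B x y n : good m B -> x < B -> y < B -> x <> y ->
  dv (modulus m x) (n * modulus m y) -> dv (modulus m x) n.
Proof.
move=> [_ gm] xB yB xy H.
suff [d dB Hd] : exists2 d, d < B & dv (modulus m x) (n * (d + 1)).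
  have [e E] := gm d dB.
  apply: (@dv_add _ (n * (d + 1) * (e * (x + 1)))); last exact: dv_mulr.
  by exists n; rewrite /modulus E; ring.
have H1 := @dv_mulr _ _ (x + 1) H.
have [/ltm_ex[d E]|[//|/ltm_ex[d E]]] := ltm_ltm x y; exists d.
- by apply: lem_ltm_trans yB; rewrite -E.
- apply: dv_add H1; exists (n * (y + 1)).
  by rewrite -E /modulus; ring.
- by apply: lem_ltm_trans xB; rewrite -E.
- apply: (@dv_add _ (n * (y + 1) * modulus m x)); last by exists (n * (y + 1)); ring.
  suff -> : n * (y + 1) * modulus m x + n * (d + 1) = n * modulus m y * (x + 1) by [].
  by rewrite -E /modulus; ring.
Qed.

Lemma modulus_ndvd1 m x : 0 < m -> ~ dv (modulus m x) 1.
Proof.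
move=> /ltm_ex[z <-] [q]; have [->|[t ->]] := pred_ex q.
  by rewrite mulm0 -[1]add0m => /succ_neq0.
rewrite /modulus => E; apply: (@succ_neq0 ((z * x + z + x) * (t + 1) + t + t)).
by apply: (@addmI 1); rewrite [RHS]add0m [RHS]E; ring.
Qed.

(* [u] belongs to the set coded by [n], relative to [m]; the divisibility is
   stated with a bounded quantifier. *)
Definition inm m n u := exists q, q < n + 1 /\ n = modulus m u * q.

Lemma inmP m n u : inm m n u <-> dv (modulus m u) n.
Proof.
split=> [[q [_ ->]]|[q E]]; first exact: dv_mul.
exists q; split=> //; apply/ltmS; rewrite E /modulus.
by exists (m * (u + 1) * q); ring.
Qed.

Lemma inm1 m B u : good m B -> ~ inm m 1 u.
Proof. by move=> [m0 _] /inmP; apply: modulus_ndvd1. Qed.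

(** Multiplying n by the modulus of y adds y and, by [modulus_dvd], nothing else below B. *)
Lemma inm_adjoin m B n y : good m B -> y < B -> exists n', forall x, x < B ->
  inm m n' x <-> (inm m n x \/ x = y).
Proof.
move=> gm yB; exists (n * modulus m y) => x xB; rewrite !inmP; split.
  by move=> H; have [->|xy] := pselect (x = y); [right|left; apply: (modulus_dvd gm xB yB xy H)].
case=> [|->]; first exact: dv_mulr.
by exists n; ring.
Qed.

Definition finm (m n u : term) : formula :=
  BEx (n + 1) (tlift 1 n = (tlift 1 m * (tlift 1 u + 1) + 1) * 'v_0).

(* The pair (t, a) of the set coded by m, n is (0, 0), or it follows from
   another pair of that set by the rule that defines the number [a] of the
   elements of {s < t | (s, i) in Z}. *)
Definition justified (Z : nset M) (i m n t a : N) :=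
  ~ (t = 0 /\ a = 0) -> exists t', t' < t /\ (t = t' + 1 /\
    ((smem (pr t' i) Z -> exists a', a' < a /\ (a = a' + 1 /\ inm m n (pr t' a'))) /\
     (~ smem (pr t' i) Z -> inm m n (pr t' a)))).

Definition fjustified (Z : nat) (i m n t a : term) : formula :=
  ~ (t = 0 /\ a = 0) ==>> BEx t (tlift 1 t = 'v_0 + 1 /\
    ((MemS (tpair 'v_0 (tlift 1 i)) Z ==>>
      BEx (tlift 1 a) (tlift 2 a = 'v_0 + 1 /\ finm (tlift 2 m) (tlift 2 n) (tpair 'v_1 'v_0))) /\
     (~ MemS (tpair 'v_0 (tlift 1 i)) Z ==>> finm (tlift 1 m) (tlift 1 n) (tpair 'v_0 (tlift 1 a))))).

(** A certificate: by induction on t, any pair (t, a) of the coded set that is below B carries the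
    true count a. No pair is required to be present, so histories are easy to extend. *)
Definition history (Z : nset M) (i B m n : N) :=
  forall u, u < B -> forall t, t < u + 1 -> forall a, a < u + 1 ->
    u = pr t a -> inm m n u -> justified Z i m n t a.

Definition fhistory (Z : nat) (i B m n : term) : formula :=
  BAll B (BAll ('v_0 + 1) (BAll ('v_1 + 1)
    ('v_2 = tpair 'v_1 'v_0 ==>> finm (tlift 3 m) (tlift 3 n) 'v_2 ==>>
     fjustified Z (tlift 3 i) (tlift 3 m) (tlift 3 n) 'v_1 'v_0))).

Lemma historyP Z i B m n t a :
  history Z i B m n -> pr t a < B -> inm m n (pr t a) -> justified Z i m n t a.
Proof.
move=> H tB; apply: H => //; apply/ltmS; [exact: pr_lel|exact: pr_ler].
Qed.

(** * The counting function of the fibers of a set *)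

Section Count.
Variable Z : nset M.

Definition is_count i x j :=
  exists B m n, pr x j < B /\ history Z i B m n /\ inm m n (pr x j).

Lemma is_count_ex i x : exists j, is_count i x j.
Proof.
(* All pairs (t, a) with a <= t <= x are below B, so a single modulus serves while the history
   grows. *)
pose B := pr x x + 1; have [m gm] := good_ex B.
suff : forall y, exists n, y < x + 1 -> history Z i B m n /\ exists j, j < y + 1 /\ inm m n (pr y j).
  move=> /(_ x)[n /(_ (ltmSm _))[hn [j [/ltmS jx xj]]]]; exists j, B, m, n; split=> //.
  by apply/ltmS; apply: pr_mono.
(* A history can be extended by one justified pair: enlarging the set does not destroy the
   justifications of the old pairs. *)
have adj n t a : t <= x -> a <= t -> history Z i B m n -> justified Z i m n t a ->
    exists n', history Z i B m n' /\ inm m n' (pr t a).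
  move=> tx at_ hn jt; have tB : pr t a < B by apply/ltmS; apply: pr_mono => //; apply: lem_trans at_ tx.
  have [n' Hn'] := inm_adjoin n gm tB; exists n'; split; last by apply/Hn' => //; right.
  move=> u uB t1 _ a1 _ Eu /Hn'-/(_ uB) Hu nz.
  have : justified Z i m n t1 a1.
    case: Hu => Hu; last by move: Hu; rewrite Eu => /pr_inj[-> ->].
    by apply: historyP hn _ _; rewrite -?Eu.
  move=> /(_ nz)[t' [t't [Et [H1 H2]]]]; exists t'; do 2!split=> //.
  have lt' a' : a' <= a1 -> pr t' a' < B.
    by move=> H; apply: lem_ltm_trans uB; rewrite Eu; apply: pr_mono => //; apply: ltmW.
  split=> [/H1[a' [a'a [Ea Ha]]]|/H2 Ha].
    exists a'; do 2!split=> //; apply/Hn'; [exact/lt'/ltmW|by left].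
  by apply/Hn'; [exact: lt'|left].
sigma1_ind [:: i; x; B; m] [:: Z] ('v_1 < 'v_3 + 1 ==>> fhistory 0 'v_2 'v_4 'v_5 'v_0 /\
  BEx ('v_1 + 1) (finm 'v_6 'v_1 (tpair 'v_2 'v_0)))%F.
  (* The starting point is the empty history, coded by 1, to which the pair (0, 0) is added. *)
  have [||n [hn h0]] := @adj 1 0 0 (lem0 x) (lem0 _).
  - by move=> u _ t _ a _ _ /(inm1 gm).
  - by case.
  - by exists n => _; split=> //; exists 0; split.
move=> y [n Hn]; have [yx|yx] := ltmP (y + 1) (x + 1); last first.
  by exists n => H; case/ltmNge: yx.
have y1x : y + 1 <= x by apply/ltmS.
have [|hn [j [jy Hj]]] := Hn; first by apply: ltm_trans yx.
have [Zy|nZy] := pselect (smem (pr y i) Z).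
  have [||||n' [hn' h']] := adj n (y + 1) (j + 1) => //.
  - exact/ltmE.
  - by move=> _; exists y; split=> //; split=> //; split=> [_|/(_ Zy)//]; exists j.
  - by exists n' => _; split=> //; exists (j + 1); split=> //; apply/ltmS/ltmE.
have [||||n' [hn' h']] := adj n (y + 1) j => //.
- exact: ltmW.
- by move=> _; exists y; split=> //; split=> //; split.
- by exists n' => _; split=> //; exists j; split=> //; apply/ltmS/ltmW.
Qed.

Lemma is_count_fun i x j j' : is_count i x j -> is_count i x j' -> j = j'.
Proof.
move=> [B [m [n [jB [hn Hj]]]]] [B' [m' [n' [jB' [hn' Hj']]]]].
(* The two certificates may have different bounds and moduli. Bounding a and a' by them makes the
   claim [Delta0], so that induction on t applies. *)
suff : forall t a, a < B -> forall a', a' < B' -> pr t a < B -> inm m n (pr t a) ->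
    pr t a' < B' -> inm m' n' (pr t a') -> a = a'.
  by apply; eauto; [apply: lem_ltm_trans jB|apply: lem_ltm_trans jB']; apply: pr_ler.
delta0_ind [:: B; m; n; B'; m'; n'] [::] (BAll 'v_1 (BAll 'v_5 (tpair 'v_2 'v_1 < 'v_3 ==>>
  finm 'v_4 'v_5 (tpair 'v_2 'v_1) ==>> tpair 'v_2 'v_0 < 'v_6 ==>>
  finm 'v_7 'v_8 (tpair 'v_2 'v_0) ==>> 'v_1 = 'v_0)))%F.
  move=> a _ a' _ aB Ha aB' Ha'.
  have zero h Bh mh nh : history Z i Bh mh nh -> pr 0 h < Bh -> inm mh nh (pr 0 h) -> h = 0.
    move=> H1 H2 H3; apply: contrapT => nz.
    by have [[]//|t [/ltm0]] := historyP H1 H2 H3.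
  by rewrite (zero _ _ _ _ hn aB Ha) (zero _ _ _ _ hn' aB' Ha').
move=> t IH a _ a' _ aB Ha aB' Ha'.
have step h Bh mh nh : history Z i Bh mh nh -> pr (t + 1) h < Bh -> inm mh nh (pr (t + 1) h) ->
    exists h', [/\ h' < Bh, pr t h' < Bh, inm mh nh (pr t h'),
      smem (pr t i) Z -> h = h' + 1 & ~ smem (pr t i) Z -> h = h'].
  move=> H1 H2 H3.
  have lth h' : h' <= h -> pr t h' < Bh.
    by move=> Hh; apply: lem_ltm_trans H2; apply: pr_mono => //; apply: ltmW.
  have [[/succ_neq0//]|t' [_ [/succ_inj <- [Hz Hn]]]] := historyP H1 H2 H3.
  have [z|z] := pselect (smem (pr t i) Z).
    have [h' [/ltmW h'h [-> I]]] := Hz z; exists h'; split=> //; [|exact: lth].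
    by apply: lem_ltm_trans (lth _ h'h); apply: pr_ler.
  by exists h; split=> //; [apply: lem_ltm_trans H2; apply: pr_ler|exact: lth|exact: Hn].
have [b [b1 b2 b3 b4 b5]] := step _ _ _ _ hn aB Ha.
have [b' [b'1 b'2 b'3 b'4 b'5]] := step _ _ _ _ hn' aB' Ha'.
have E := IH b b1 b' b'1 b2 b3 b'2 b'3.
have [z|z] := pselect (smem (pr t i) Z); first by rewrite b4 // b'4 // E.
by rewrite b5 // b'5 // E.
Qed.

Lemma is_count0 i : is_count i 0 0.
Proof.
have [j Hj] := is_count_ex i 0; have [B [m [n [jB [hn Hn]]]]] := Hj.
suff E : j = 0 by rewrite -{2}E.
apply: contrapT => nz.
by have [[]//|t [/ltm0]] := historyP hn jB Hn.
Qed.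

(** Instead of extending a history for x, the proof takes one for x + 1, which exists by
    [is_count_ex]; the justification of its last pair leads back to x, where uniqueness identifies
    the count as j. *)
Lemma is_countS i x j : is_count i x j ->
  (smem (pr x i) Z -> is_count i (x + 1) (j + 1)) /\ (~ smem (pr x i) Z -> is_count i (x + 1) j).
Proof.
move=> xj; have [h Hh] := is_count_ex i (x + 1); have [B [m [n [hB [hn Hn]]]]] := Hh.
have [[/succ_neq0//]|t [_ [/succ_inj <- [H1 H2]]]] := historyP hn hB Hn.
have lth h' : h' <= h -> inm m n (pr x h') -> h' = j.
  move=> Hh' I; apply: is_count_fun xj; exists B, m, n; split=> //.
  by apply: lem_ltm_trans hB; apply: pr_mono => //; apply: ltmW.
split=> [/H1[h' [/ltmW h'h [Eh I]]]|/H2 I]; first by rewrite -(lth _ h'h I) -Eh.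
by rewrite -(lth h).
Qed.

Lemma count_ex : exists (cnt : N -> N -> N) (C : nset M),
  [/\ forall i x j, smem (pr (pr i x) j) C <-> j = cnt i x,
      forall i, cnt i 0 = 0,
      forall i x, smem (pr x i) Z -> cnt i (x + 1) = cnt i x + 1
    & forall i x, ~ smem (pr x i) Z -> cnt i (x + 1) = cnt i x].
Proof.
pose cnt i x := sval (cid (is_count_ex i x)).
have cntP i x j : is_count i x j <-> j = cnt i x.
  have H := svalP (cid (is_count_ex i x)); by split=> [/is_count_fun E|->]; [exact: E H|exact: H].
(* A common bound u on the three parts of a certificate reduces [is_count] to one unbounded
   quantifier. *)
pose W u i x j := exists B, B < u /\ exists m, m < u /\ exists n, n < u /\
  (pr x j < B /\ history Z i B m n /\ inm m n (pr x j)).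
pose fW (u i x j : term) := BEx u (BEx (tlift 1 u) (BEx (tlift 2 u)
   (tpair (tlift 3 x) (tlift 3 j) < 'v_2 /\ fhistory 0 (tlift 3 i) 'v_2 'v_1 'v_0 /\
    finm 'v_1 'v_0 (tpair (tlift 3 x) (tlift 3 j)))))%F.
have WP u i x j : W u i x j -> is_count i x j.
  by move=> [B [_ [m [_ [n [_ H]]]]]]; exists B, m, n.
have WE i x : exists u, W u i x (cnt i x) /\ cnt i x < u.
  have [B [m [n [xB H]]]] := (cntP i x _).2 erefl; exists (B + m + n + 1).
  have lt z : z <= B + m + n -> z < B + m + n + 1 by move=> ?; apply/ltmS.
  have BB : B <= B + m + n by rewrite -addmA.
  split; last by apply: lt; apply: lem_trans BB; apply: ltmW; apply: lem_ltm_trans xB; apply: pr_ler.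
  exists B; split; first exact: lt.
  exists m; split; first by apply: lt; rewrite (addmC B) -addmA.
  by exists n; split; first exact: lt.
have [C HC] : exists C, forall y, smem y C <-> exists u, exists i, i < y + 1 /\
    exists x, x < y + 1 /\ exists j, j < y + 1 /\ (y = pr (pr i x) j /\ W u i x j).
  (* The Pi^0_1 form: no certificate below u certifies a value below u other than j. Every
     certificate appears for large u, and a certified value exists, so this determines j. *)
  pose Q u y := exists i, i < y + 1 /\ exists x, x < y + 1 /\ exists j, j < y + 1 /\
    (y = pr (pr i x) j /\ forall j', j' < u -> W u i x j' -> j' = j).
  delta1_compr Q [::] [:: Z]
    (BEx ('v_1 + 1) (BEx ('v_2 + 1) (BEx ('v_3 + 1)
      ('v_4 = tpair (tpair 'v_2 'v_1) 'v_0 /\ fW 'v_3 'v_2 'v_1 'v_0))))%F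
    (BEx ('v_1 + 1) (BEx ('v_2 + 1) (BEx ('v_3 + 1)
      ('v_4 = tpair (tpair 'v_2 'v_1) 'v_0 /\ BAll 'v_3 (fW 'v_4 'v_3 'v_2 'v_0 ==>> 'v_0 = 'v_1)))))%F.
  move=> y; split=> [[u /triple_bound[i [x [j [E /WP/cntP Hj]]]]] u'|H].
    by apply/triple_bound; exists i, x, j; split=> // j' _ /WP/cntP ->.
  have /triple_bound[i [x [j0 [E _]]]] := H 0.
  have [u [Hu ju]] := WE i x; have /triple_bound[i' [x' [j [E' Hj]]]] := H u.
  have [/pr_inj[Ei Ex] _] := pr_inj (etrans (esym E) E').
  exists u; apply/triple_bound; exists i, x, (cnt i x); split=> //.
  by rewrite E' -Ei -Ex; congr pr; apply/esym/Hj; rewrite -?Ei -?Ex.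
exists cnt, C; split=> [i x j|i|i x|i x].
- rewrite HC; split=> [[u /triple_bound[i' [x' [j' [E Hj]]]]]|->].
    by have [/pr_inj[-> ->] ->] := pr_inj E; move/WP/cntP: Hj.
  by have [u [Hu _]] := WE i x; exists u; apply/triple_bound; exists i, x, (cnt i x).
- by apply/esym/cntP; apply: is_count0.
- by move=> z; apply/esym/cntP; apply: (is_countS _).1 => //; apply/cntP.
- by move=> z; apply/esym/cntP; apply: (is_countS _).2 => //; apply/cntP.
Qed.

End Count.
Definition counting Z (cnt : N -> N -> N) (C : nset M) :=
  [/\ forall i x j, smem (pr (pr i x) j) C <-> j = cnt i x,
      forall i, cnt i 0 = 0,
      forall i x, smem (pr x i) Z -> cnt i (x + 1) = cnt i x + 1
    & forall i x, ~ smem (pr x i) Z -> cnt i (x + 1) = cnt i x].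

Section CountTheory.
Variables (Z C : nset M) (cnt : N -> N -> N).
Hypothesis cntZ : counting Z cnt C.

Lemma countP i x j : smem (pr (pr i x) j) C <-> j = cnt i x.
Proof. by case: cntZ. Qed.

Lemma count0 i : cnt i 0 = 0. Proof. by case: cntZ. Qed.

Lemma countS i x : smem (pr x i) Z -> cnt i (x + 1) = cnt i x + 1.
Proof. by case: cntZ => _ _ H _; apply: H. Qed.

Lemma countN i x : ~ smem (pr x i) Z -> cnt i (x + 1) = cnt i x.
Proof. by case: cntZ => _ _ _; apply. Qed.

Lemma count_mono i x y : x <= y -> cnt i x <= cnt i y.
Proof.
(* The claim is expressed through the graph C, so that it becomes an admissible induction
   formula. *)
move=> [z <-]; suff [d /countP <-] : exists d, smem (pr (pr i (x + z)) (cnt i x + d)) C by [].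
move: z; sigma1_ind [:: i; x; cnt i x] [:: C] (MemS (tpair (tpair 'v_2 ('v_3 + 'v_1)) ('v_4 + 'v_0)) 0)%F.
  by exists 0; rewrite !addm0; apply/countP.
move=> z [d /countP Hd]; have [H|H] := pselect (smem (pr (x + z) i) Z).
  by exists (d + 1); apply/countP; rewrite !addmS Hd countS.
by exists d; apply/countP; rewrite Hd addmS countN.
Qed.

Lemma count_lt i x y : smem (pr x i) Z -> x < y -> cnt i x < cnt i y.
Proof. by move=> Zx /ltmE /(count_mono i) H; apply/ltmE; rewrite -countS. Qed.

Lemma count_le i x : cnt i x <= x.
Proof.
suff [j [/ltmS jx /countP <-]] : exists j, j < x + 1 /\ smem (pr (pr i x) j) C by [].
move: x; delta0_ind [:: i] [:: C] (BEx ('v_0 + 1) (MemS (tpair (tpair 'v_2 'v_1) 'v_0) 0))%F.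
  by exists 0; split=> //; apply/countP; rewrite count0.
move=> x [j [jx /countP Hj]]; have [H|H] := pselect (smem (pr x i) Z).
  exists (j + 1); split; last by apply/countP; rewrite countS // Hj.
  by apply/ltmS/ltmE.
exists j; split; last by apply/countP; rewrite countN // Hj.
exact: ltm_trans jx _.
Qed.

(** The count starts at 0 and grows by one exactly at the elements of the fiber; on its way past a
    it must leave the value a at such an element. *)
Lemma count_surj i a x : a < cnt i x -> exists t, t < x /\ (smem (pr t i) Z /\ cnt i t = a).
Proof.
suff : forall j, j < x + 1 -> smem (pr (pr i x) j) C -> a < j ->
    exists t, t < x /\ (smem (pr t i) Z /\ smem (pr (pr i t) a) C).
  move=> H H1; have [|t [tx [Zt /countP ->]]] := H (cnt i x) _ ((countP _ _ _).2 erefl) H1; last by exists t.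
  by apply/ltmS/count_le.
move: x; delta0_ind [:: i; a] [:: Z; C] (BAll ('v_0 + 1) (MemS (tpair (tpair 'v_2 'v_1) 'v_0) 1 ==>>
  'v_3 < 'v_0 ==>> BEx 'v_1 (MemS (tpair 'v_0 'v_3) 0 /\ MemS (tpair (tpair 'v_3 'v_0) 'v_4) 1)))%F.
  by move=> j _ /countP ->; rewrite count0 => /ltm0.
move=> x IH j _ /countP -> aj.
have IH' : a < cnt i x -> exists t, t < x + 1 /\ (smem (pr t i) Z /\ smem (pr (pr i t) a) C).
  move=> H; have [|t [tx Ht]] := IH (cnt i x) _ ((countP _ _ _).2 erefl) H; first exact/ltmS/count_le.
  by exists t; split=> //; apply: ltm_trans tx _.
have [H|H] := pselect (smem (pr x i) Z); last by apply: IH'; move: aj; rewrite countN.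
move: aj; rewrite countS // => /ltmS/lem_eqVlt[->|//].
by exists x; split=> //; split=> //; apply/countP.
Qed.

Lemma count_empty i x : (forall t, ~ smem (pr t i) Z) -> cnt i x = 0.
Proof.
move=> H; suff /countP <- : smem (pr (pr i x) 0) C by [].
move: x; delta0_ind [:: i] [:: C] (MemS (tpair (tpair 'v_1 'v_0) 0) 0)%F.
  by apply/countP; rewrite count0.
by move=> x /countP E; apply/countP; rewrite countN.
Qed.

End CountTheory.

(** * Comparison of the counts of two fibers *)

Section CountCompare.
Variables (Z C Z' C' : nset M) (cnt cnt' : N -> N -> N) (i i' : N).
Hypothesis cntZ : counting Z cnt C.
Hypothesis cntZ' : counting Z' cnt' C'.

Lemma count_ext x : (forall t, smem (pr t i) Z <-> smem (pr t i') Z') -> cnt i x = cnt' i' x.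
Proof.
move=> H; suff [j [/(countP cntZ) <- /(countP cntZ') <-]] : exists j,
  smem (pr (pr i x) j) C /\ smem (pr (pr i' x) j) C' by [].
move: x; sigma1_ind [:: i; i'] [:: C; C']
  (MemS (tpair (tpair 'v_2 'v_1) 'v_0) 0 /\ MemS (tpair (tpair 'v_3 'v_1) 'v_0) 1)%F.
  by exists 0; split; [apply/(countP cntZ)|apply/(countP cntZ')]; rewrite ?(count0 cntZ) ?(count0 cntZ').
move=> x [j [/(countP cntZ) E /(countP cntZ') E']].
have [z|z] := pselect (smem (pr x i) Z).
  exists (j + 1); split; first by apply/(countP cntZ); rewrite (countS cntZ) // E.
  by apply/(countP cntZ'); rewrite (countS cntZ') ?E' //; apply/H.
exists j; split; first by apply/(countP cntZ); rewrite (countN cntZ) // E.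
by apply/(countP cntZ'); rewrite (countN cntZ') ?E' // => /H.
Qed.

(** The counts agree up to t0 and differ by one afterwards; the induction on x carries both
    phases. *)
Lemma count_add1 t0 x : ~ smem (pr t0 i) Z ->
  (forall t, smem (pr t i') Z' <-> (smem (pr t i) Z \/ t = t0)) -> t0 < x ->
  cnt' i' x = cnt i x + 1.
Proof.
move=> N0 H tx; suff [j [/(countP cntZ) <- [/(_ tx) /(countP cntZ') <-]]] : exists j,
  smem (pr (pr i x) j) C /\ ((t0 < x -> smem (pr (pr i' x) (j + 1)) C') /\
    (~ t0 < x -> smem (pr (pr i' x) j) C')) by [].
move: x {tx}; sigma1_ind [:: i; i'; t0] [:: C; C']
  (MemS (tpair (tpair 'v_2 'v_1) 'v_0) 0 /\
   (('v_4 < 'v_1 ==>> MemS (tpair (tpair 'v_3 'v_1) ('v_0 + 1)) 1) /\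
    (~ 'v_4 < 'v_1 ==>> MemS (tpair (tpair 'v_3 'v_1) 'v_0) 1)))%F.
  exists 0; split; first by apply/(countP cntZ); rewrite (count0 cntZ).
  split=> [/ltm0//|_]; by apply/(countP cntZ'); rewrite (count0 cntZ').
move=> x [j [/(countP cntZ) E [E1 E2]]].
have [tx|[tx|xt]] := ltm_ltm t0 x.
- have {}E1 := (countP cntZ' _ _ _).1 (E1 tx).
  have nt : x <> t0 by move=> xt; move: tx; rewrite xt => /ltm_irr.
  have tx1 : t0 < x + 1 by apply: ltm_trans tx _.
  have [z|z] := pselect (smem (pr x i) Z).
    exists (j + 1); split; first by apply/(countP cntZ); rewrite (countS cntZ) // E.
    split=> // _; apply/(countP cntZ'); rewrite (countS cntZ') ?E1 //.
    by apply/H; left.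
  exists j; split; first by apply/(countP cntZ); rewrite (countN cntZ) // E.
  split=> // _; apply/(countP cntZ'); rewrite (countN cntZ') ?E1 //.
  by move/H => [].
- subst x; have {}E2 : j = cnt' i' t0 by apply/(countP cntZ')/E2 => /ltm_irr.
  exists j; split; first by apply/(countP cntZ); rewrite (countN cntZ) // E.
  split=> [_|[]//].
  by apply/(countP cntZ'); rewrite (countS cntZ') ?E2 //; apply/H; right.
- have nt : ~ t0 < x by apply/ltmNge/ltmW.
  have {}E2 : j = cnt' i' x by apply/(countP cntZ')/E2.
  have ne : x <> t0 by move=> e; move: xt; rewrite e => /ltm_irr.
  have nt1 : ~ t0 < x + 1 by apply/ltmNge/ltmE.
  have [z|z] := pselect (smem (pr x i) Z).
    exists (j + 1); split; first by apply/(countP cntZ); rewrite (countS cntZ) // E.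
    split=> // _; apply/(countP cntZ'); rewrite (countS cntZ') ?E2 //.
    by apply/H; left.
  exists j; split; first by apply/(countP cntZ); rewrite (countN cntZ) // E.
  split=> // _; apply/(countP cntZ'); rewrite (countN cntZ') ?E2 //.
  by move/H => [].
Qed.

End CountCompare.

(** * Codes of finite sets and their cardinality in the model *)

Definition fin x c := exists k m n, c = pr k (pr m n) /\ (x < k /\ dv (modulus m x) n).

Definition finb x c := exists k, k < c + 1 /\ exists m, m < c + 1 /\ exists n, n < c + 1 /\
  (c = pr k (pr m n) /\ x < k /\ inm m n x).

Definition ffinb (x c : term) : formula :=
  BEx (c + 1) (BEx (tlift 1 c + 1) (BEx (tlift 2 c + 1)
    (tlift 3 c = tpair 'v_2 (tpair 'v_1 'v_0) /\ tlift 3 x < 'v_2 /\ finm 'v_1 'v_0 (tlift 3 x)))).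

Lemma finbP x c : finb x c <-> fin x c.
Proof.
split=> [[k [_ [m [_ [n [_ [E [xk /inmP H]]]]]]]]|[k [m [n [E [xk /inmP H]]]]]].
  by exists k, m, n.
exists k; split; first by apply/ltmS; rewrite E; apply: pr_lel.
exists m; split; first by apply/ltmS; rewrite E; apply: lem_trans (pr_ler _ _); apply: pr_lel.
exists n; split=> //; by apply/ltmS; rewrite E; apply: lem_trans (pr_ler _ _); apply: pr_ler.
Qed.

Lemma fin_lt x c : fin x c -> x < c.
Proof. by move=> [k [m [n [-> [xk _]]]]]; apply: ltm_lem_trans xk (pr_lel _ _). Qed.

(** Every coded finite set becomes a fiber of the one set E, so that the counting function of E
    measures all of them. *)
Lemma fin_set_ex : exists E, forall x s, smem (pr x s) E <-> fin x s.
Proof.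
have [E HE] : exists E, forall y, smem y E <->
    exists x, x < y + 1 /\ exists s, s < y + 1 /\ (y = pr x s /\ finb x s).
  delta0_compr [::] [::] (BEx ('v_0 + 1) (BEx ('v_1 + 1) ('v_2 = tpair 'v_1 'v_0 /\ ffinb 'v_1 'v_0)))%F.
exists E => x s; rewrite HE double_bound; split=> [[x' [s' [/pr_inj[-> ->] /finbP//]]]|/finbP H].
by exists x, s.
Qed.

(** The elements of Z below B are adjoined one at a time, all with respect to one modulus. *)
Lemma finite_compr Z B : exists c, forall x, fin x c <-> (x < B /\ smem x Z).
Proof.
have [m gm] := good_ex B.
suff [n Hn] : exists n, forall x, x < B -> (inm m n x <-> x < B /\ smem x Z).
  exists (pr B (pr m n)) => x; split=> [[k [m' [n' [/pr_inj[<- /pr_inj[<- <-]] [xB /inmP H]]]]]|[xB xZ]].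
    exact/Hn.
  by exists B, m, n; split=> //; split=> //; apply/inmP/Hn.
suff : forall y, exists n, forall x, x < B -> (inm m n x <-> x < y /\ smem x Z) by apply.
sigma1_ind [:: B; m] [:: Z] (BAll 'v_2 (finm 'v_4 'v_1 'v_0 <-> 'v_0 < 'v_2 /\ MemS 'v_0 0))%F.
  by exists 1 => x xB; split=> [/(inm1 gm)//|[/ltm0]].
move=> y [n Hn]; have [[yB yZ]|nyZ] := pselect (y < B /\ smem y Z).
  have [n' Hn'] := inm_adjoin n gm yB; exists n' => x xB; rewrite Hn' // Hn //.
  split=> [[[xy xZ]|->//]|[/ltmS/lem_eqVlt[->|xy] xZ]]; [|by right|by left].
  by split=> //; apply: ltm_trans xy _.
exists n => x xB; rewrite Hn //; split=> -[xy xZ]; split=> //; first exact: ltm_trans xy _.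
have [E|//] := (lem_eqVlt _ _).1 ((ltmS _ _).1 xy).
by case: nyZ; rewrite -E.
Qed.

(** Let the fiber v of Z' consist of the elements that the bijection matches with numbers below v.
    Passing from v to v + 1 adds exactly one element, so by induction the fiber v has count v; for v
    = n it is the given fiber. *)
Lemma bij_count Z C cnt i n c X : counting Z cnt C ->
  (forall u, fin u c -> exists a t, u = pr a t /\ (a < n /\ smem (pr t i) Z)) ->
  (forall a, a < n -> exists t, fin (pr a t) c /\ forall t', fin (pr a t') c -> t' = t) ->
  (forall t, smem (pr t i) Z -> exists a, fin (pr a t) c /\ forall a', fin (pr a' t) c -> a' = a) ->
  (forall t, smem (pr t i) Z -> t < X) -> cnt i X = n.
Proof.
move=> cZ H1 H2 H3 HX.
have [Z' HZ'] : exists Z', forall y, smem y Z' <-> exists t, t < y + 1 /\ exists v, v < y + 1 /\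
    (y = pr t v /\ exists a, a < v /\ finb (pr a t) c).
  delta0_compr [:: c] [::] (BEx ('v_0 + 1) (BEx ('v_1 + 1) ('v_2 = tpair 'v_1 'v_0 /\
    BEx 'v_0 (ffinb (tpair 'v_0 'v_2) 'v_4))))%F.
have {}HZ' t v : smem (pr t v) Z' <-> exists a, a < v /\ fin (pr a t) c.
  rewrite HZ' double_bound; split=> [[t' [v' [/pr_inj[-> ->] [a [av /finbP]]]]]|[a [av /finbP]]].
    by exists a.
  by move=> H; exists t, v; split=> //; exists a.
have [cnt' [C' cZ']] := count_ex Z'.
suff /(countP cZ') -> : smem (pr (pr n X) n) C'.
  apply: (count_ext cZ cZ') => t; rewrite HZ'; split=> [/H3[a [Ha _]]|[a [an Ha]]].
    by exists a; split=> //; have [a' [t' [/pr_inj[-> _] []]]] := H1 _ Ha.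
  by have [a' [t' [/pr_inj[_ ->] []]]] := H1 _ Ha.
suff : forall v, v < n + 1 -> smem (pr (pr v X) v) C' by apply.
delta0_ind [:: n; X] [:: C'] ('v_0 < 'v_1 + 1 ==>> MemS (tpair (tpair 'v_0 'v_2) 'v_0) 0)%F.
  move=> _; apply/(countP cZ'); rewrite (count_empty cZ') // => t /HZ'[a [/ltm0]] //.
move=> v IH vn; have /(countP cZ') E := IH (ltm_trans (ltmSm _) vn).
have {vn} vn : v < n by apply/ltmE/ltmS.
have [t0 [Ht0 U]] := H2 _ vn; apply/(countP cZ').
have Zt0 : smem (pr t0 i) Z by have [a [t [/pr_inj[_ ->] []]]] := H1 _ Ht0.
rewrite (@count_add1 _ _ _ _ _ _ v _ cZ' cZ' t0) -?E //; last exact: HX.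
  move/HZ' => [a [av Ha]]; have [a' [_ Ua]] := H3 _ Zt0.
  by move: av; rewrite (Ua _ Ha) (Ua _ Ht0) => /ltm_irr.
move=> t; rewrite !HZ'; split=> [[a [/ltmS/lem_eqVlt[-> /U|av] Ha]]|[[a [av Ha]]|->]].
- by right.
- by left; exists a.
- by exists a; split=> //; apply: ltm_trans av _.
- by exists v.
Qed.

(** Like [fin], written connective by connective as [holds] unfolds the object formula, here
    [FCard], so that conversion identifies the two. *)
Definition fcard s n := exists c,
  (forall u, fin u c -> exists a t, u = pr a t /\ (a < n /\ fin t s)) /\
  ((forall a, a < n -> exists t, fin (pr a t) c /\ forall t', fin (pr a t') c -> t' = t) /\
   (forall t, fin t s -> exists a, fin (pr a t) c /\ forall a', fin (pr a' t) c -> a' = a)).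

(** The elements of s are smaller than s, so the count at s includes all of them. Conversely,
    sending each element to the number of smaller ones gives a bijection, which has to be coded. *)
Lemma fcardP E C cnt s n : (forall x s, smem (pr x s) E <-> fin x s) -> counting E cnt C ->
  fcard s n <-> n = cnt s s.
Proof.
move=> HE cE; split=> [[c [H1 [H2 H3]]]|->].
  apply/esym; apply: (bij_count (c := c) cE) => //.
  - by move=> u /H1[a [t [Eu [an /HE H]]]]; exists a, t.
  - by move=> t /HE /H3.
  - by move=> t /HE /fin_lt.
have [G HG] : exists G, forall y, smem y G <-> exists a, a < y + 1 /\ exists t, t < y + 1 /\
    (y = pr a t /\ (smem (pr t s) E /\ smem (pr (pr s t) a) C)).
  delta0_compr [:: s] [:: E; C] (BEx ('v_0 + 1) (BEx ('v_1 + 1) ('v_2 = tpair 'v_1 'v_0 /\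
    (MemS (tpair 'v_0 'v_3) 0 /\ MemS (tpair (tpair 'v_3 'v_0) 'v_1) 1))))%F.
(* For t in s the sum of t and its rank is below s + s, so by [pr_lt] all pairs of the bijection are
   below this bound. *)
have [c Hc] := finite_compr G (pr s s).
have {Hc}Hc u : fin u c <-> exists a t, u = pr a t /\ (fin t s /\ a = cnt s t).
  rewrite Hc HG double_bound; split=> [[_ [a [t [Eu [/HE H /(countP cE) Ea]]]]]|[a [t [-> [H Ea]]]]].
    by exists a, t.
  split; last by exists a, t; split=> //; split; [apply/HE|apply/(countP cE)].
  apply: pr_lt; rewrite Ea; apply/ltmE.
  have -> : cnt s t + t + 1 = cnt s t + (t + 1) by ring.
  apply: lem_add; last by apply/ltmE/fin_lt.
  by apply: lem_trans (count_le cE _ _) _; apply/ltmW/fin_lt.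
have Hcp a t : fin (pr a t) c <-> fin t s /\ a = cnt s t.
  by rewrite Hc; split=> [[a' [t' [/pr_inj[-> ->]]]]//|H]; exists a, t.
have lt t t' : fin t s -> t < t' -> cnt s t < cnt s t'.
  by move=> /HE; apply: (count_lt cE).
exists c; split=> [u /Hc[a [t [-> [ts ->]]]]|].
  by exists (cnt s t), t; split=> //; split=> //; apply: lt => //; apply: fin_lt.
split=> [a /(count_surj cE)[t [_ [/HE ts Ea]]]|t ts]; last first.
  by exists (cnt s t); split=> [|a /Hcp[]//]; apply/Hcp.
exists t; split=> [|t' /Hcp[t's Ea']]; first by apply/Hcp.
have [/(lt _ _ t's)|[//|/(lt _ _ ts)]] := ltm_ltm t' t; by rewrite Ea -Ea' => /ltm_irr.
Qed.

(** * Exactly large sets in the model *)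

Definition felarge s := (forall c, c < s -> ~ forall x, fin x c <-> fin x s) /\
  exists m, fin m s /\ ((forall x, fin x s -> ~ x < m) /\ fcard s (m + 1)).

(** Relative to E and C all quantifiers can be bounded: elements are smaller than their code, and
    the cardinality is read off from C instead of being witnessed by a bijection. *)
Lemma felarge_set_ex : exists D, forall s, smem s D <-> felarge s.
Proof.
have [E HE] := fin_set_ex; have [cnt [C cE]] := count_ex E.
have [D HD] : exists D, forall s, smem s D <->
    (forall c, c < s -> ~ forall x, x < s -> smem (pr x c) E <-> smem (pr x s) E) /\
    exists m, m < s /\ (smem (pr m s) E /\
      ((forall x, x < s -> smem (pr x s) E -> ~ x < m) /\ smem (pr (pr s s) (m + 1)) C)).
  delta0_compr [::] [:: E; C] (BAll 'v_0 (~ BAll 'v_1 (MemS (tpair 'v_0 'v_1) 0 <-> MemS (tpair 'v_0 'v_2) 0)) /\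
    BEx 'v_0 (MemS (tpair 'v_0 'v_1) 0 /\
     (BAll 'v_1 (MemS (tpair 'v_0 'v_2) 0 ==>> ~ 'v_0 < 'v_1) /\
      MemS (tpair (tpair 'v_1 'v_1) ('v_0 + 1)) 1)))%F.
exists D => s; rewrite HD /felarge; split=> -[H1 [m H2]]; split.
- move=> c cs Hc; case: (H1 _ cs) => x _; rewrite !HE; exact: Hc.
- have [_ [/HE ms [H3 /(countP cE) H4]]] := H2; exists m; split=> //; split.
    by move=> x xs; apply: H3; [apply: fin_lt|apply/HE].
  exact/(fcardP _ _ HE cE).
- move=> c cs Hc; case: (H1 _ cs) => x; split=> Hx.
    by apply/HE/Hc; [apply: ltm_trans (fin_lt Hx) cs|apply/HE].
  by apply/HE/Hc; [apply: fin_lt|apply/HE].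
- have [ms [H3 H4]] := H2; exists m; split; first exact: fin_lt.
  split; first exact/HE; split; first by move=> x _ /HE /H3.
  exact/(countP cE)/(fcardP _ _ HE cE).
Qed.

Lemma felargeP v w j : holds v w (FElarge (Var j)) <-> felarge (v j).
Proof.
(* [~ All1] of an equivalence has the syntactic shape of [Ex1], because [And] unfolds to a negation.
   [holds] therefore reads this clause as an existential statement, and the detour through [sat]
   restores the intended reading. *)
have code : holds v w (FCode (Var j)) <-> forall c, c < v j -> ~ forall x, fin x c <-> fin x (v j).
  have key x c : (fin x c <-> fin x (v j)) <->
      sat (scons x (scons c v)) w (FIn 'v_0 'v_1 <-> FIn 'v_0 (tlift 2 (Var j)))%F.
    exact: (holdsE (scons x (scons c v)) w (FIn 'v_0 'v_1 <-> FIn 'v_0 (tlift 2 (Var j)))%F).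
  rewrite holdsE; split=> H c cs Hc; apply: (H c cs) => x; apply/key; exact: Hc.
by split=> -[/code H1 H2].
Qed.

Definition felarge_in s X := felarge s /\ forall x, fin x s -> smem x X.

Lemma felarge_inP v w j X : holds v w (FElarge_in (Var j) X) <-> felarge_in (v j) (w X).
Proof.
by split=> -[H1 H2]; [exact: conj ((felargeP v w j).1 H1) H2
                     |exact: conj ((felargeP v w j).2 H1) H2].
Qed.

(** * The coloring by counts in the model *)

Section Coloring.
Variables (k : N) (F : nset M).
Hypothesis F_dom : forall y, smem y F -> exists s i, y = pr s i /\ felarge s.
Hypothesis F_fun : forall s, felarge s ->
  exists i, smem (pr s i) F /\ forall i', smem (pr s i') F -> i' = i.
Hypothesis F_bounded : forall i, exists b n,
  (forall x, fin x b <-> smem (pr x i) F) /\ (fcard b n /\ ~ k < n).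

Lemma coloring_ex : exists G cnt C, [/\ counting F cnt C,
  forall s j, smem (pr s j) G <-> exists i, smem (pr s i) F /\ j = cnt i s
  & forall y, smem y G -> exists s j, y = pr s j /\ felarge s].
Proof.
have [D HD] := felarge_set_ex; have [cnt [C cF]] := count_ex F.
(* The Pi^0_1 form speaks of every value u of s under F. Membership in D ensures that there is one;
   otherwise numbers that are not exactly large would qualify vacuously. *)
pose Q u y := exists s, s < y + 1 /\ exists j, j < y + 1 /\
   (y = pr s j /\ (smem s D /\ (smem (pr s u) F -> smem (pr (pr u s) j) C))).
have [G HG] : exists G, forall y, smem y G <-> exists u, exists s, s < y + 1 /\ exists j, j < y + 1 /\
   (y = pr s j /\ (smem (pr s u) F /\ smem (pr (pr u s) j) C)).
  delta1_compr Q [::] [:: F; D; C]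
   (BEx ('v_1 + 1) (BEx ('v_2 + 1) ('v_3 = tpair 'v_1 'v_0 /\
     (MemS (tpair 'v_1 'v_2) 0 /\ MemS (tpair (tpair 'v_2 'v_1) 'v_0) 2))))%F
   (BEx ('v_1 + 1) (BEx ('v_2 + 1) ('v_3 = tpair 'v_1 'v_0 /\
     (MemS 'v_1 1 /\ (MemS (tpair 'v_1 'v_2) 0 ==>> MemS (tpair (tpair 'v_2 'v_1) 'v_0) 2)))))%F.
  move=> y; split=> [[u /double_bound[s [j [E [H1 H2]]]]] u'|H].
    have [s' [i' [/pr_inj[Es _] es]]] := F_dom H1; rewrite -Es in es.
    apply/double_bound; exists s, j; split=> //; split=> [|H3]; first exact/HD.
    by have [i [_ U]] := F_fun es; rewrite (U _ H3) -(U _ H1).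
  have /double_bound[s [j [E [/HD es _]]]] := H 0.
  have [i [Hi _]] := F_fun es; have /double_bound[s' [j' [E' [_ H']]]] := H i.
  have [Es Ej] := pr_inj (etrans (esym E) E').
  by exists i; apply/double_bound; exists s, j; split=> //; split=> //; rewrite Ej Es; apply: H'; rewrite -Es.
exists G, cnt, C; split=> // [s j|y].
  rewrite HG; split=> [[i /double_bound[s' [j' [/pr_inj[-> ->] [H1 /(countP cF) ->]]]]]|[i [H1 H2]]].
    by exists i.
  by exists i; apply/double_bound; exists s, j; split=> //; split=> //; apply/(countP cF).
move=> /HG[i /double_bound[s [j [E [/F_dom[s' [i' [/pr_inj[Es _] es]]] _]]]]].
by exists s, j; split=> //; rewrite Es.
Qed.

(** The code b of the fiber exceeds its elements, so the count at b is the full n, whereas the count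
    at s does not yet include s. *)
Lemma count_fiber_lt C cnt s i : counting F cnt C -> smem (pr s i) F -> cnt i s < k.
Proof.
move=> cF Hs; have [b [n [Hb [[c [H1 [H2 H3]]] nk]]]] := F_bounded i.
have E : cnt i b = n.
  apply: (bij_count (c := c) cF) => //.
  - by move=> u /H1[a [t [Eu [an /Hb H]]]]; exists a, t.
  - by move=> t /Hb /H3.
  - by move=> t /Hb /fin_lt.
have /(count_lt cF Hs) : s < b by apply/fin_lt/Hb.
by rewrite E => /ltm_lem_trans; apply; apply/ltmNge.
Qed.

End Coloring.

Lemma rrt_of_rt (v : nat -> N) w : holds v w (FRT (Var 0) ==>> FRRT (Var 0))%F.
Proof.
set k := v 0%N.
have -> : holds v w (FRT (Var 0) ==>> FRRT (Var 0))%F =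
  (holds v w (FRT (Var 0)) -> holds v w (FRRT (Var 0))) by [].
move=> HRT F [[F1 F2] FB].
have F_dom y : smem y F -> exists s i, y = pr s i /\ felarge s.
  by move=> /F1[s [i [E H]]]; exists s, i; split=> //; apply: (felargeP _ w 1).1 H.
have F_fun s : felarge s -> exists i, smem (pr s i) F /\ forall i', smem (pr s i') F -> i' = i.
  by move=> H; apply: F2; apply: (felargeP _ w 0).2 H.
have F_bounded i : exists b n,
    (forall x, fin x b <-> smem (pr x i) F) /\ (fcard b n /\ ~ k < n).
  by have [b [n [[_ H1] H2]]] := FB i; exists b, n.
have [G [cnt [C [cF HG G_dom]]]] := coloring_ex F_dom F_fun.
have [|H [Hinf [c Hc]]] := HRT G.
- split; [split|].
  + by move=> y /G_dom[s [j [E es]]]; exists s, j; split=> //; apply: (felargeP _ w 1).2 es.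
  + move=> s es'; have es := (felargeP _ w 0).1 es'.
    have [i [Hi U]] := F_fun _ es; exists (cnt i s); split.
      by apply/HG; exists i.
    by move=> j /HG[i' [/U Ei Ej]]; rewrite -Ei; exact: Ej.
  + move=> s j /HG[i [Hi Ej]].
    by have := count_fiber_lt F_bounded cF Hi; rewrite -[cnt i s]Ej.
exists H; split=> // s t i Hs' Ht' Fs Ft.
have Hs := (felarge_inP _ (scons H (scons F w)) 2 0).1 Hs'.
have Ht := (felarge_inP _ (scons H (scons F w)) 1 0).1 Ht'.
have E : cnt i s = cnt i t.
  have col s' : felarge_in s' H -> smem (pr s' i) F -> cnt i s' = c.
    move=> Hs1 Fs'; apply: (Hc _).1; exists s'; split; first exact: (felarge_inP _ (scons H (scons G w)) 0 0).2 Hs1.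
    by apply/HG; exists i.
  by rewrite (col s) // (col t).
have [st|[//|ts]] := ltm_ltm s t.
- by have := count_lt cF Fs st; rewrite E => /ltm_irr.
- by have := count_lt cF Ft ts; rewrite E => /ltm_irr.
Qed.

End Arithmetic.

Theorem RCA0_rrt_of_rt : proves RCA0 [::] (All1 (Imp (FRT (Var 0)) (FRRT (Var 0)))).
Proof.
by apply: completeness => M HM v w k; apply: (rrt_of_rt HM (w 0)).
Qed.

(** * Turing functionals *)

From mathcomp Require Import finmap classical_sets functions cardinality.

Lemma mkseq_cons T (f : nat -> T) n : mkseq f n.+1 = f 0 :: mkseq (f \o succn) n.
Proof. by rewrite /mkseq /= -[1]/(1 + 0) iotaDl -map_comp. Qed.

(** * Closure properties of computability relative to an oracle *)

Section Computable.
Variable dom : set (set nat).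

(* [F] is computed by one index, uniformly in the oracles of [dom]; the
   arguments are given as a list. *)
Definition computable n (F : set nat -> seq nat -> nat) :=
  exists e : prec n, forall X, dom X -> forall v : n.-tuple nat, eval X e v (F X v).

Lemma computable_ext n F G :
  (forall X v, dom X -> size v = n -> F X v = G X v) -> computable n F -> computable n G.
Proof.
move=> E [e He]; exists e => X dX v; rewrite -E ?size_tuple //; exact: He.
Qed.

Lemma computable_var n i : i < n -> computable n (fun _ v => nth 0 v i).
Proof. by move=> lin; exists (PProj (Ordinal lin)) => X _ v /=; rewrite (tnth_nth 0). Qed.

Lemma computable_comp m n F G : computable m F -> (forall i, i < m -> computable n (G i)) ->
  computable n (fun X v => F X (mkseq (fun i => G i X v) m)).
Proof.
move=> [e He] HG.
have /choice[g Hg] (i : 'I_m) : exists e, forall X, dom X -> forall v : n.-tuple nat, eval X e v (G i X v).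
  exact: HG.
exists (PComp e g) => X dX v; exists [tuple of mkseq (fun i => G i X v) m]; last exact: He.
by move=> i; rewrite (tnth_nth 0) /= nth_mkseq //; apply: Hg.
Qed.

Lemma computable_zero n : computable n (fun _ _ => 0).
Proof. by exists (PZero n). Qed.

Lemma computable_succ n F : computable n F -> computable n (fun X v => (F X v).+1).
Proof.
move=> HF; apply: (@computable_comp 1 n (fun _ v => (nth 0 v 0).+1) (fun _ => F)) => //.
by exists PSucc => X _ v /=; rewrite /thead (tnth_nth 0).
Qed.

Lemma computable_oracle n F : computable n F -> computable n (fun X v => `[< X (F X v) >]).
Proof.
move=> HF; apply: (@computable_comp 1 n (fun X v => `[< X (nth 0 v 0) >]) (fun _ => F)) => //.
by exists POracle => X _ v /=; rewrite /thead (tnth_nth 0).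
Qed.

Fixpoint primrec (F : seq nat -> nat) (G : seq nat -> nat) k v :=
  if k is k.+1 then G [:: k, primrec F G k v & v] else F v.

Lemma computable_rec n B F G : computable n B -> computable n F -> computable n.+2 G ->
  computable n (fun X v => primrec (F X) (G X) (B X v) v).
Proof.
move=> HB [e He] [g Hg].
(* [PRec] recurses on its first argument, so the bound becomes an argument here; composition then
   substitutes [B] for it. *)
pose A (X : set nat) v := primrec (F X) (G X) (head 0 v) (behead v).
have HA : computable n.+1 A.
  exists (PRec e g) => X dX v; exists (fun i => primrec (F X) (G X) i (behead v)).
  split=> [|i _|]; [exact: He|exact: Hg|].
  by rewrite /A /thead (tnth_nth 0) nth0.
have := computable_comp HA (G := fun i => if i is i.+1 then fun _ v => nth 0 v i else B).
move=> /(_ n)/(_ _)/computable_ext; apply=> [X v _ <-|[|i] lin //]; last exact: (@computable_var n i lin).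
by rewrite mkseq_cons /A /=; congr primrec; apply: mkseq_nth.
Qed.

Lemma computable_drop2 n F : computable n F ->
  computable n.+2 (fun X v => F X (behead (behead v))).
Proof.
move=> HF; have := computable_comp HF (G := fun i _ v => nth 0 v i.+2).
move=> /(_ n.+2)/(_ _)/computable_ext; apply=> [X [//|a [//|b v]] _ [<-]|i lin].
  by rewrite /= mkseq_nth.
exact: computable_var.
Qed.

Lemma computable_drop1 n F : computable n.+1 F ->
  computable n.+2 (fun X v => F X (head 0 v :: behead (behead v))).
Proof.
move=> HF; have := computable_comp HF (G := fun i _ v => nth 0 v (if i is i.+1 then i.+2 else 0)).
move=> /(_ n.+2)/(_ _)/computable_ext; apply=> [X [//|a [//|b v]] _ [<-]|[|i] lin].
- by rewrite mkseq_cons /=; congr (F X (_ :: _)); apply: mkseq_nth.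
- exact: computable_var.
- exact: computable_var.
Qed.

Lemma computable_behead n F : computable n F -> computable n.+1 (fun X v => F X (behead v)).
Proof.
move=> HF; have := computable_comp HF (G := fun i _ v => nth 0 v i.+1).
move=> /(_ n.+1)/(_ _)/computable_ext; apply=> [X [//|a v] _ [<-]|i lin].
  by rewrite /= mkseq_nth.
exact: computable_var.
Qed.

Lemma computable_app1 n h F : computable 1 (fun X v => h X (nth 0 v 0)) ->
  computable n F -> computable n (fun X v => h X (F X v)).
Proof. by move=> Hh HF; apply: (computable_comp (G := fun _ => F) Hh). Qed.

Lemma computable_app2 n h F G : computable 2 (fun X v => h X (nth 0 v 0) (nth 0 v 1)) ->
  computable n F -> computable n G -> computable n (fun X v => h X (F X v) (G X v)).
Proof.
move=> Hh HF HG; apply: (computable_comp (G := fun i => if i is 0 then F else G) Hh).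
by case.
Qed.

Lemma computable_min n F mu : computable n.+1 F ->
  (forall X v, dom X -> F X (mu X v :: v) = 0 /\ forall i, i < mu X v -> 0 < F X (i :: v)) ->
  computable n mu.
Proof.
move=> [e He] H; exists (PMin e) => X dX v; have [H0 H1] := H X v dX; split.
  by rewrite -H0; apply: (He X dX [tuple of _ :: v]).
move=> i /H1 Fi; exists (F X (i :: v)).-1; rewrite prednK //.
exact: (He X dX [tuple of _ :: v]).
Qed.

Lemma computable_add n F G : computable n F -> computable n G -> computable n (fun X v => F X v + G X v).
Proof.
move=> HF HG; have := computable_rec HG HF (computable_succ (@computable_var n.+2 1 isT)).
apply: computable_ext => X v _ _; elim: (G X v) => [|m IH] /=; first by rewrite addn0.
by rewrite IH addnS.
Qed.

Lemma computable_mul n F G : computable n F -> computable n G -> computable n (fun X v => F X v * G X v).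
Proof.
move=> HF HG; have := computable_rec HG (computable_zero n)
  (computable_add (computable_drop2 HF) (@computable_var n.+2 1 isT)).
apply: computable_ext => X v _ _; elim: (G X v) => [|m IH] /=; first by rewrite muln0.
by rewrite IH mulnS.
Qed.

Lemma computable_exp n F G : computable n F -> computable n G -> computable n (fun X v => F X v ^ G X v).
Proof.
move=> HF HG; have := computable_rec HG (computable_succ (computable_zero n))
  (computable_mul (computable_drop2 HF) (@computable_var n.+2 1 isT)).
apply: computable_ext => X v _ _; elim: (G X v) => [|m IH] //=.
by rewrite IH expnS.
Qed.

Lemma computable_pred n F : computable n F -> computable n (fun X v => (F X v).-1).
Proof.
move=> HF; have := computable_rec HF (computable_zero n) (@computable_var n.+2 0 isT).
by apply: computable_ext => X v _ _; case: (F X v).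
Qed.

Lemma computable_sub n F G : computable n F -> computable n G -> computable n (fun X v => F X v - G X v).
Proof.
move=> HF HG; have := computable_rec HG HF (computable_pred (@computable_var n.+2 1 isT)).
apply: computable_ext => X v _ _; elim: (G X v) => [|m IH] /=; first by rewrite subn0.
by rewrite IH subnS.
Qed.

Lemma computable_sum n B F : computable n B -> computable n.+1 F ->
  computable n (fun X v => \sum_(i < B X v) F X (nat_of_ord i :: v)).
Proof.
move=> HB HF; have := computable_rec HB (computable_zero n)
  (computable_add (@computable_var n.+2 1 isT) (computable_drop1 HF)).
apply: computable_ext => X v _ _; elim: (B X v) => [|m IH] /=; first by rewrite big_ord0.
by rewrite IH big_ord_recr.
Qed.

Lemma computable_not n (P : set nat -> seq nat -> bool) :
  computable n (fun X v => P X v) -> computable n (fun X v => ~~ P X v).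
Proof.
move=> HP; have := computable_sub (computable_succ (computable_zero n)) HP.
by apply: computable_ext => X v _ _; case: (P X v).
Qed.

Lemma computable_and n (P Q : set nat -> seq nat -> bool) :
  computable n (fun X v => P X v) -> computable n (fun X v => Q X v) ->
  computable n (fun X v => P X v && Q X v).
Proof.
move=> HP HQ; have := computable_mul HP HQ.
by apply: computable_ext => X v _ _; rewrite mulnb.
Qed.

Lemma computable_leq n F G : computable n F -> computable n G -> computable n (fun X v => F X v <= G X v).
Proof.
move=> HF HG; have := computable_sub (computable_succ (computable_zero n)) (computable_sub HF HG).
by apply: computable_ext => X v _ _; rewrite /leq; case: (F X v - G X v).
Qed.

Lemma computable_eq n F G : computable n F -> computable n G -> computable n (fun X v => F X v == G X v).
Proof.
move=> HF HG; have := computable_and (computable_leq HF HG) (computable_leq HG HF).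
by apply: computable_ext => X v _ _; rewrite eqn_leq.
Qed.

Lemma computable_odd n F : computable n F -> computable n (fun X v => odd (F X v)).
Proof.
move=> HF; have := computable_rec HF (computable_zero n)
  (computable_sub (computable_succ (computable_zero _)) (@computable_var n.+2 1 isT)).
apply: computable_ext => X v _ _; elim: (F X v) => [|m IH] //=.
by rewrite IH; case: (odd m).
Qed.

Lemma sum_iota_leq n q : \sum_(i < n) (i < q : nat) = minn n q.
Proof.
elim: n => [|n IH]; first by rewrite big_ord0 min0n.
rewrite big_ord_recr /= IH; case: ltnP => nq.
  by rewrite (minn_idPl nq) addn1.
by rewrite addn0 (minn_idPr _) // ltnW.
Qed.

(** The quotient of a by b > 0 is the number of i < a such that (i + 1) b <= a. *)
Lemma computable_div n F G : (forall X v, 0 < G X v) ->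
  computable n F -> computable n G -> computable n (fun X v => F X v %/ G X v).
Proof.
move=> G0 HF HG.
have H := computable_leq (computable_mul (computable_succ (@computable_var n.+1 0 isT))
  (computable_behead HG)) (computable_behead HF).
have := computable_sum HF H.
apply: computable_ext => X v _ _ /=.
rewrite (eq_bigr (fun i : 'I__ => (i < F X v %/ G X v : nat))) => [|i _]; last by rewrite leq_divRL.
by rewrite sum_iota_leq (minn_idPr _) // leq_div.
Qed.

End Computable.

(** * Decoding the canonical indices of finite sets *)

Definition bit x c : bool := odd (c %/ 2 ^ x).

(** A positive sum of truth values acts as a bounded existential quantifier, in a form covered by
    [computable_sum]. The witness m is the least set bit of c, and c has m + 1 set bits. *)
Definition elarge_code c : bool :=
  0 < \sum_(m < c) ((bit m c && (\sum_(x < m) bit x c == 0)) && (\sum_(x < c) bit x c == m.+1)).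

Section Codes.
Variable dom : set (set nat).
Local Notation computable := (computable dom).

Lemma computable_bit n F G : computable n F -> computable n G ->
  computable n (fun X v => bit (F X v) (G X v)).
Proof.
move=> HF HG; apply: computable_odd; apply: computable_div => //.
  by move=> X v; rewrite expn_gt0.
by apply: computable_exp => //; do 2!apply: computable_succ; apply: computable_zero.
Qed.

Lemma computable_elarge_code n F : computable n F -> computable n (fun X v => elarge_code (F X v)).
Proof.
apply: (@computable_app1 _ n (fun _ c => elarge_code c)).
have one m : computable m (fun _ _ => 1) by apply: computable_succ; apply: computable_zero.
apply: (@computable_leq _ _ (fun _ _ => 1)) => //.
pose body (X : set nat) (v : seq nat) : nat := (bit (nth 0 v 0) (nth 0 v 1) &&
  (\sum_(x < nth 0 v 0) bit x (nth 0 v 1) == 0)) && (\sum_(x < nth 0 v 1) bit x (nth 0 v 1) == (nth 0 v 0).+1).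
apply: (computable_sum (F := body)); first exact: (@computable_var _ 1 0).
have Hs i : i < 2 -> computable 2 (fun X v => \sum_(x < nth 0 v i) bit x (nth 0 v 1)).
  move=> i2; apply: (computable_sum (F := fun X w => bit (nth 0 w 0) (nth 0 w 2))).
    exact: computable_var.
  by apply: computable_bit; apply: computable_var.
rewrite /body; apply: computable_and; first apply: computable_and.
- by apply: computable_bit; apply: computable_var.
- by apply: computable_eq; [apply: Hs|apply: computable_zero].
- by apply: computable_eq; [apply: Hs|apply: computable_succ; apply: computable_var].
Qed.

End Codes.

Lemma bit0 c : bit 0 c = odd c.
Proof. by rewrite /bit expn0 divn1. Qed.

Lemma bitS x c : bit x.+1 c = bit x c./2.
Proof. by rewrite /bit expnS divnMA divn2. Qed.

Lemma sum_bits_recl N (b : nat -> bool) :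
  \sum_(i < N.+1) b i * 2 ^ i = b 0 + (\sum_(i < N) b i.+1 * 2 ^ i).*2.
Proof.
rewrite big_ord_recl /= expn0 muln1; congr (_ + _).
rewrite -muln2 big_distrl /=; apply: eq_bigr => i _.
by rewrite /bump /= add1n expnSr mulnA.
Qed.

Lemma bit_sum N (b : nat -> bool) x : bit x (\sum_(i < N) b i * 2 ^ i) = (x < N) && b x.
Proof.
elim: N b x => [|N IH] b x; first by rewrite big_ord0 /bit div0n.
rewrite sum_bits_recl; case: x => [|x].
  by rewrite bit0 oddD odd_double addbF; case: (b 0).
by rewrite bitS half_bit_double (IH (b \o succn)).
Qed.

Lemma sum_bit N c : c < 2 ^ N -> \sum_(i < N) bit i c * 2 ^ i = c.
Proof.
elim: N c => [|N IH] c; first by rewrite expn0 ltnS leqn0 big_ord0 => /eqP.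
rewrite expnS mul2n => cN; rewrite (sum_bits_recl _ (bit^~ c)) bit0.
rewrite (eq_bigr (fun i : 'I_N => bit i c./2 * 2 ^ i)) => [|i _]; last by rewrite bitS.
by rewrite IH ?odd_double_half // ltn_half_double.
Qed.

Lemma fset_iota (s : {fset nat}) N : (forall x, x \in s -> x < N) ->
  perm_eq [seq x <- iota 0 N | x \in s] s.
Proof.
move=> sN; apply: uniq_perm; rewrite ?filter_uniq ?iota_uniq // => x.
rewrite mem_filter mem_iota add0n leq0n /=.
by have [/sN ->|] := boolP (x \in s).
Qed.

Lemma fset_codeE (s : {fset nat}) N : (forall x, x \in s -> x < N) ->
  fset_code s = \sum_(i < N) (nat_of_ord i \in s) * 2 ^ i.
Proof.
move=> sN; rewrite /fset_code -(perm_big _ (fset_iota sN)) big_filter big_mkcond /=.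
rewrite -[N in iota 0 N]subn0 -/(index_iota 0 N) big_mkord.
by apply: eq_bigr => i _; case: (_ \in _); rewrite ?mul1n ?mul0n.
Qed.

Lemma mem_lt_code (s : {fset nat}) x : x \in s -> x < fset_code s.
Proof.
move=> xs; apply: leq_trans (ltn_expl x (ltnSn 1)) _.
by rewrite /fset_code (bigD1_seq x) //= leq_addr.
Qed.

Lemma bit_code x (s : {fset nat}) : bit x (fset_code s) = (x \in s).
Proof.
pose N := maxn x.+1 (fset_code s).
rewrite [in LHS](@fset_codeE s N) => [|y /mem_lt_code ys]; last by rewrite leq_max ys orbT.
by rewrite (bit_sum _ (fun i => i \in s)) leq_maxl.
Qed.

Lemma fset_code_inj : injective fset_code.
Proof. by move=> s t E; apply/fsetP => x; rewrite -!bit_code E. Qed.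

Lemma fset_code_surj c : exists s, fset_code s = c.
Proof.
pose s := [fset x in [seq x <- iota 0 c | bit x c]]%fset.
have sE x : (x \in s) = bit x c && (x < c).
  by rewrite !inE /= mem_filter mem_iota leq0n add0n.
exists s; rewrite (@fset_codeE _ c) => [|x]; last by rewrite sE => /andP[].
rewrite -[RHS](sum_bit (ltn_expl c (ltnSn 1))); apply: eq_bigr => i _.
by rewrite sE ltn_ord andbT.
Qed.

Lemma exactly_largeP (s : {fset nat}) :
  reflect (exists m, [/\ m \in s, forall x, x \in s -> m <= x & #|` s| = m.+1]) (exactly_large s).
Proof.
apply: (iffP existsP) => [[m /andP[/forallP H /eqP E]]|[m [ms H E]]].
  exists (val m); split=> //; first exact: valP.
  by move=> x xs; apply: (H [` xs]%fset).
exists [` ms]%fset; rewrite E eqxx andbT; apply/forallP => x; apply: H; exact: valP.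
Qed.

Lemma elarge_code_fset s : elarge_code (fset_code s) = exactly_large s.
Proof.
have card : \sum_(x < fset_code s) bit x (fset_code s) = #|` s|.
  rewrite -(perm_size (fset_iota (@mem_lt_code s))) size_filter -sum1_count.
  rewrite -[X in iota 0 X]subn0 -/(index_iota 0 _) big_mkord [RHS]big_mkcond /=.  by apply: eq_bigr => i _; rewrite bit_code; case: (_ \in _).
rewrite /elarge_code lt0n sum_nat_eq0 negb_forall card; apply/existsP/exactly_largeP.
  move=> [m]; rewrite implyTb eqb0 negbK => /andP[/andP[ms /eqP H] /eqP E].
  exists (nat_of_ord m); split=> //; first by rewrite -bit_code.
  move=> x xs; rewrite leqNgt; apply/negP => xm.
  move/eqP: H; rewrite sum_nat_eq0 => /forallP/(_ (Ordinal xm)).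
  by rewrite /= bit_code xs.
move=> [m [ms H E]]; exists (Ordinal (mem_lt_code ms)); rewrite implyTb eqb0 negbK /=.
rewrite bit_code ms E eqxx andbT /= sum_nat_eq0; apply/forallP => x; rewrite implyTb eqb0 bit_code.
by apply/negP => /H; rewrite leqNgt ltn_ord.
Qed.

Definition ecode (s : elarge) : nat := fset_code (val s).

Lemma ecode_inj : injective ecode.
Proof. by move=> s t /fset_code_inj/val_inj. Qed.

Lemma elarge_codeP c : elarge_code c <-> exists s, ecode s = c.
Proof.
have [s <-] := fset_code_surj c; rewrite elarge_code_fset; split=> [es|[t E]].
  by exists (Sub s es); rewrite /ecode SubK.
by rewrite -(fset_code_inj E); apply: valP.
Qed.

Lemma npair_inj i j i' j' : npair i j = npair i' j' -> i = i' /\ j = j'.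
Proof.
have lt a b c d : a + b < c + d -> npair a b < npair c d.
  move=> H; rewrite /npair; apply: (@leq_trans ((a + b).+1 ^ 2)).
    rewrite -!mulnn mulSn mulnS addnA [leqRHS]addnC ltn_add2l.
    by rewrite !addSn ltnS -!addnA leq_addr.
  by apply: leq_trans (leq_addr _ _); rewrite leq_exp2r.
have [/lt H E|/lt H E|E] := ltngtP (i + j) (i' + j'); do ?by move: H; rewrite E ltnn.
rewrite /npair E => /addnI Ei; split=> //.
by move: E; rewrite Ei => /addnI.
Qed.

Lemma graphP f s y : graph f (npair (ecode s) y) <-> y = f s.
Proof.
split=> [[t _ /npair_inj[/ecode_inj -> ->]]//|->].
by exists s.
Qed.

Lemma graph_inj f g : graph f = graph g -> f = g.
Proof.
by move=> E; apply: funext => s; apply/graphP; rewrite -E; apply/graphP.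
Qed.

Local Open Scope classical_set_scope.
Local Open Scope card_scope.

(** * The coloring by ranks within fibers *)

Definition rank_in (X : set nat) c v : nat := \sum_(d < c) `[< X (npair d v) >].

Definition rank_coloring (f : elarge -> nat) (s : elarge) : nat :=
  rank_in (graph f) (ecode s) (f s).

Lemma rank_in_lt X c d v : X (npair c v) -> c < d -> rank_in X c v < rank_in X d v.
Proof.
move=> Xc cd; rewrite /rank_in -!(big_mkord xpredT (fun d => (`[< X (npair d v) >] : nat))).
rewrite [ltnRHS](big_cat_nat (n := c.+1)) //= [in ltnRHS]big_nat_recr //= asboolT // addn1.
exact: leq_addr.
Qed.

(** The sets counted by the rank, together with s itself, are rank + 1 members of one fiber. Hence
    the list r extends up to and including the code of s, and the inequality is strict. *)
Lemma rank_coloring_bound k f s : bounded_fun k f -> rank_coloring f s < k.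
Proof.
move=> /(_ (f s)) fk; rewrite -card_le_II; apply: card_le_trans fk.
pose P c := `[< graph f (npair c (f s)) >].
pose r := [seq c <- iota 0 (ecode s).+1 | P c].
have -> : (rank_coloring f s).+1 = #|` [fset c in r]%fset|.
  rewrite card_fseq undup_id ?filter_uniq ?iota_uniq // size_filter -sum1_count.
  rewrite -[X in iota 0 X]subn0 -/(index_iota 0 _) big_mkord big_mkcond big_ord_recr /=.
  rewrite [P _]asboolT ?addn1; last exact/graphP.
  by congr _.+1; apply: eq_bigr => d _; rewrite -/(P d); case: (P d).
apply: (@card_le_trans _ _ _ [set` [fset c in r]%fset]).
  have /card_eqPle[//] : [set` [fset c in r]%fset] #= `I_#|` [fset c in r]%fset|.
  exact/card_eq_fsetP.
apply: card_le_trans (card_image_le ecode _); apply: subset_card_le => c /=.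
rewrite !inE mem_filter => /andP[/asboolP[t _ /npair_inj[Ec Ef]] _].
by exists t.
Qed.

Lemma rank_coloring_inj f s t : rank_coloring f s = rank_coloring f t -> f s = f t -> s = t.
Proof.
move=> E Ef; apply: ecode_inj; have [st|ts|//] := ltngtP (ecode s) (ecode t).
  have := rank_in_lt ((graphP f s (f s)).2 erefl) st.
  by rewrite {2}Ef -/(rank_coloring f s) -/(rank_coloring f t) E ltnn.
have := rank_in_lt ((graphP f t (f t)).2 erefl) ts.
by rewrite -{2}Ef -/(rank_coloring f s) -/(rank_coloring f t) E ltnn.
Qed.

(** * Computing the coloring uniformly from the graph of the instance *)

Section Reduction.

(** Oracles are restricted to graphs of total functions, so that the unbounded search for a value
    always terminates. *)
Definition graphs : set (set nat) := [set X | exists f, X = graph f].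
Local Notation computable := (computable graphs).

(** The value 0 off the codes of exactly large sets is the outcome of the search in
    [computable_fiber_value], whose test succeeds at once there. *)
Definition fiber_value (X : set nat) c : nat :=
  if elarge_code c then xget 0 [set v | X (npair c v)] else 0.

Lemma fiber_valueE f s : fiber_value (graph f) (ecode s) = f s.
Proof.
rewrite /fiber_value (_ : elarge_code _ = true); last by apply/elarge_codeP; exists s.
apply: xget_unique => [|y]; first exact/graphP.
by move=> /graphP.
Qed.

Lemma computable_npair n F G : computable n F -> computable n G ->
  computable n (fun X v => npair (F X v) (G X v)).
Proof.
move=> HF HG; apply: computable_add => //; apply: computable_exp; first exact: computable_add.
by do 2!apply: computable_succ; apply: computable_zero.
Qed.

Lemma computable_fiber_value n F : computable n F -> computable n (fun X v => fiber_value X (F X v)).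
Proof.
apply: (@computable_app1 _ _ fiber_value).
have H : computable 2 (fun X v => elarge_code (nth 0 v 1) && ~~ `[< X (npair (nth 0 v 1) (nth 0 v 0)) >]).
  apply: computable_and; first by apply: computable_elarge_code; apply: computable_var.
  by apply: computable_not; apply: computable_oracle; apply: computable_npair; apply: computable_var.
apply: (computable_min H) => X v [f ->] /=; move: (nth 0 v 0) => c.
have [/elarge_codeP[s <-]|ne] := boolP (elarge_code c).
  rewrite fiber_valueE asboolT ?andbF; last exact/graphP.
  by split=> // i ifs; rewrite asboolF ?andbT // => /graphP E; rewrite E ltnn in ifs.
by rewrite /fiber_value (negbTE ne).
Qed.

Lemma computable_rank_in n F G : computable n F -> computable n G ->
  computable n (fun X v => rank_in X (F X v) (G X v)).
Proof.
apply: (@computable_app2 _ _ rank_in).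
apply: (computable_sum (F := fun X w => `[< X (npair (nth 0 w 0) (nth 0 w 2)) >])).
  exact: computable_var.
by apply: computable_oracle; apply: computable_npair; apply: computable_var.
Qed.

(** Both components of a pair are at most the pair itself, so unpairing y is a bounded search. *)
Definition in_rank_graph (X : set nat) y : bool :=
  0 < \sum_(c < y.+1) \sum_(j < y.+1)
    ((elarge_code c && (npair c j == y)) && (j == rank_in X c (fiber_value X c) :> nat)).

Lemma computable_in_rank_graph : computable 1 (fun X v => in_rank_graph X (nth 0 v 0)).
Proof.
have one m : computable m (fun _ _ => 1) by apply: computable_succ; apply: computable_zero.
apply: (@computable_leq _ _ (fun _ _ => 1)) => //.
pose body (X : set nat) (v : seq nat) : nat :=
  (elarge_code (nth 0 v 1) && (npair (nth 0 v 1) (nth 0 v 0) == nth 0 v 2)) &&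
  (nth 0 v 0 == rank_in X (nth 0 v 1) (fiber_value X (nth 0 v 1))).
pose inner (X : set nat) (v : seq nat) : nat := \sum_(j < (nth 0 v 1).+1) body X (nat_of_ord j :: v).
apply: (computable_sum (F := inner)); first by apply: computable_succ; apply: computable_var.
apply: computable_sum; first by apply: computable_succ; apply: computable_var.
rewrite /body; apply: computable_and; first apply: computable_and.
- by apply: computable_elarge_code; apply: computable_var.
- by apply: computable_eq; [apply: computable_npair|]; apply: computable_var.
- apply: computable_eq; first exact: computable_var.
  by apply: computable_rank_in; [|apply: computable_fiber_value]; apply: computable_var.
Qed.

Lemma in_rank_graphE f y : in_rank_graph (graph f) y = `[< graph (rank_coloring f) y >].
Proof.
apply/idP/asboolP => [|[s _ <-]].
  rewrite /in_rank_graph lt0n sum_nat_eq0 => /forallPn[c]; rewrite implyTb sum_nat_eq0.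
  move=> /forallPn[j]; rewrite implyTb eqb0 negbK => /andP[/andP[/elarge_codeP[s Es] /eqP Ey] /eqP Ej].
  by exists s => //; rewrite -[RHS]Ey Ej -Es fiber_valueE.
set z := npair _ _.
have cy : ecode s < z.+1 by rewrite ltnS leq_addl.
have jy : rank_coloring f s < z.+1.
  rewrite ltnS /z /npair -mulnn; apply: leq_trans (leq_addr _ _).
  have [->//|r0] := posnP (rank_coloring f s).
  by apply: leq_trans (leq_addl _ _) (leq_pmulr _ _); rewrite addn_gt0 r0 orbT.
rewrite /in_rank_graph lt0n sum_nat_eq0; apply/forallPn; exists (Ordinal cy); rewrite implyTb sum_nat_eq0.
apply/forallPn; exists (Ordinal jy); rewrite implyTb eqb0 negbK /= eqxx fiber_valueE eqxx !andbT.
by apply/elarge_codeP; exists s.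
Qed.

End Reduction.

Theorem rrt_sW_rt k : sW_le (RRT k) (RT k).
Proof.
have [Phi HPhi] := computable_in_rank_graph.
(* [POracle] returns its oracle unchanged. Neither functional depends on k. *)
exists Phi, POracle => X [f -> fk]; exists (graph (rank_coloring f)); split.
- move=> n; have := HPhi (graph f) (ex_intro _ f erefl) [tuple n].
  by rewrite in_rank_graphE.
- by exists (rank_coloring f) => // s; apply: rank_coloring_bound.
- move=> H [infH [g /graph_inj <- cH]]; exists H => //; split=> //.
  exists f => // s t /set_mem Hs /set_mem Ht; apply: rank_coloring_inj.
  (* Cardinality 1 yields a color c whose removal leaves the image empty. *)
  have /eq_cardSP[c _] := cH; rewrite II0 card_eq0 => /eqP/seteqP[sub _].
  have col u : elarge_in H u -> rank_coloring f u = c.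
    by move=> Hu; apply: contrapT => ne; apply: (sub (rank_coloring f u)); split=> //; exists u.
  by rewrite (col s Hs) (col t Ht).
Qed.

Theorem theorem3p10 :
  (forall k : nat, 0 < k -> sW_le (RRT k) (RT k)) /\
  proves RCA0 [::] (All1 (Imp (FRT (Var 0)) (FRRT (Var 0)))).
Proof.
by split=> [k _|]; [exact: rrt_sW_rt|exact: RCA0_rrt_of_rt].
Qed.
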